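(* Let $b \geq 3$ be an integer and $D \subset \{0,1,\ldots,b-1\}$ with $2 \leq \#D \leq b-1$; let $C(b,D)$ be the corresponding generalized Cantor set with Hausdorff dimension $\gamma = \log\#D/\log b$, and let $m$ be the greatest integer such that $D \subset \{m, m+1, \ldots, b-1-m\}$. Let $t \geq 2$ be an integer having the same set of prime divisors as $b$, and let $A=(a_{n})_{n \geq 1}$ be an unbounded non-decreasing sequence of positive integers. Let $f$ be a dimension function such that $r\mapsto r^{-\gamma} f(r)$ is monotonic, and let $\psi : \mathbb{N} \to (0,\infty)$ be any function. Then: (i) if $\displaystyle\sum_{i \in I \colon \psi_{A}(i) > \frac{m}{(b-1) b^{\lceil i \alpha_{2} \rceil }}} f\left(\psi_{A}(i) - \frac{m}{(b-1) b^{\lceil i \alpha_{2} \rceil }}\right) b^{i \alpha_{2} \gamma } < \infty$, then $\mathcal{H}^{f} (W_{t,A}(\psi) \cap C(b,D)) = 0$; (ii) if $\displaystyle\sum_{i \in I \colon \psi_{A}(i) > \frac{m}{(b-1) b^{\lfloor i \alpha_{1} \rfloor }}} f\left(\psi_{A}(i) - \frac{m}{(b-1) b^{\lfloor i \alpha_{1} \rfloor }}\right) b^{i \alpha_{1} \gamma} = \infty$, then $\mathcal{H}^{f} (W_{t,A}(\psi) \cap C(b,D)) = \mathcal{H}^{f}(C(b,D))$.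
   Context: The generalized Cantor set $C(b,D)$ is the set of real numbers $x \in [0,1]$ whose base-$b$ expansion uses only digits from $D$. A dimension function is a continuous, non-decreasing function $f:(0,\infty)\to(0,\infty)$ with $\lim_{r\to 0} f(r)=0$; $\mathcal{H}^f$ is the Hausdorff $f$-measure. For a sequence $A=(a_n)_{n\ge1}$ of positive integers, $W_{t,A}(\psi) = \{x \in [0,1] : |x - p/t^{a_n}| < \psi(n) \text{ for infinitely many } (p,n) \in \mathbb{N}^2\}$; $I = I(A) = \{i \in \mathbb{N} : a_n = i \text{ for some } n\}$; for $i \in I$, $\psi_A(i) = \max\{\psi(n) : a_n = i\}$. For a prime $q$, $v_q(x)$ is the exponent of $q$ in $x$, and $\alpha_1 = \min\{v_q(t)/v_q(b) : q \text{ a prime divisor of } b\}$, $\alpha_2 = \max\{v_q(t)/v_q(b) : q \text{ a prime divisor of } b\}$. $\lfloor\cdot\rfloor$, $\lceil\cdot\rceil$ are the floor and ceiling functions. *)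

(* Defs.v *)
From HB Require Import structures.
From mathcomp Require Import all_boot all_order all_algebra.
From mathcomp Require Import all_classical all_reals all_analysis.
Set Implicit Arguments. Unset Strict Implicit. Unset Printing Implicit Defensive.
Import Order.TTheory GRing.Theory Num.Theory numFieldNormedType.Exports.
Local Open Scope classical_set_scope.
Local Open Scope ring_scope.

Section Defs.
Variable R : realType.

(** Diameter of a subset of R (-oo for the empty set). *)
Definition diam (U : set R) : \bar R :=
  ereal_sup [set (`|x - y|)%:E | x in U & y in U].

(** Cost f(diam U) of a covering set, with the usual convention f(0) = 0
    (sets of diameter 0 and the empty set cost nothing). *)
Definition hcost (f : R -> R) (U : set R) : \bar R :=
  match diam U with
  | r%:E => if 0 < r then (f r)%:E else 0%E
  | +oo%E => +oo%E
  | -oo%E => 0%E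
  end.

Definition hausdorff_delta (f : R -> R) (delta : R) (E : set R) : \bar R :=
  ereal_inf [set (\sum_(i <oo) hcost f (U i))%E |
             U in [set U : nat -> set R |
                   E `<=` \bigcup_i U i /\ forall i, (diam (U i) <= delta%:E)%E]].

(** Hausdorff f-measure: lim_{delta -> 0} H^f_delta = sup_{delta > 0}. *)
Definition hausdorff_measure (f : R -> R) (E : set R) : \bar R :=
  ereal_sup [set hausdorff_delta f delta E | delta in [set d : R | 0 < d]].

Definition cantor_set (b : nat) (D : {set 'I_b}) : set R :=
  [set x : R | 0 <= x <= 1 /\
     exists d : nat -> 'I_b, (forall n, d n \in D) /\
       series (fun n : nat => (nat_of_ord (d n))%:R / (b%:R ^+ n.+1)) @ \oo --> x].

(** W_{t,A}(psi): sequences are indexed by n >= 1 (values at n = 0 ignored). *)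
Definition W_set (t : nat) (a : nat -> nat) (psi : nat -> R) : set R :=
  [set x : R | 0 <= x <= 1 /\
     ~ finite_set [set pn : nat * nat | (0 < pn.2)%N /\
           `|x - pn.1%:R / (t%:R ^+ a pn.2)| < psi pn.2]].

Definition Iset (a : nat -> nat) : set nat := [set i | exists2 n, (0 < n)%N & a n = i].

(** psi_A(i) = max { psi n : a_n = i } (a finite nonempty set for i in I). *)
Definition psiA (a : nat -> nat) (psi : nat -> R) (i : nat) : R :=
  sup [set psi n | n in [set n | (0 < n)%N /\ a n = i]].

Definition alpha_seq (b t : nat) : seq R :=
  [seq (logn q t)%:R / (logn q b)%:R | q <- primes b].
Definition alpha1 (b t : nat) : R :=
  foldr Num.min (head 0 (alpha_seq b t)) (alpha_seq b t).
Definition alpha2 (b t : nat) : R :=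
  foldr Num.max (head 0 (alpha_seq b t)) (alpha_seq b t).

End Defs.

(* Main.v *)
(** Part (i) is the Hausdorff-Cantelli argument.  With [N = ceil (i alpha_2)],
    [t^i] divides [b^N], so the points [p / t^i] are end points of level-[N]
    [b]-adic intervals, and the part of [C(b,D)] in such an interval stays at
    distance [m / ((b-1) b^N)] from both of them.

    Part (ii).  With [N = floor (i alpha_1)], [b^N] divides [t^i], so every
    level-[N] end point is some [p / t^i].  By maximality of [m], one of [m] and
    [b-1-m] is a digit [d0] of [D], and a point of [C(b,D)] whose digits
    [N, ..., N+k-1] are all [d0], with [b^-(N+k) < psi_A(i) - m / ((b-1) b^N)],
    is [psi_A(i)]-close to such an end point.  It thus suffices to study the set of
    points having infinitely many of these runs of [d0].  Prefixing each run by a digit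
    [d1 <> d0] makes overlapping runs incompatible, whence quasi-independence.
    Let [g(n) = f(b^-n) #D^n].
    - If [g] is bounded, Chebyshev's inequality shows that the words of length [L]
      avoiding all the runs from some index on have proportion tending to [0], and
      the exceptional set is [H^f]-null.
    - Otherwise [g] increases to infinity and the measure is infinite: given a
      cover of small total cost by cylinders, one constructs greedily, run after
      run, a point outside the cover, keeping the cost of the cover inside the
      current cylinder below a fixed multiple of the cost of that cylinder. *)
Require Import Defs.
From HB Require Import structures.
From mathcomp Require Import all_boot all_order all_algebra.
From mathcomp Require Import all_classical all_reals all_analysis.
From mathcomp Require Import ring lra zify.
Import Order.TTheory GRing.Theory Num.Theory numFieldNormedType.Exports.
Local Open Scope classical_set_scope.
Local Open Scope ring_scope.
Set Implicit Arguments. Unset Strict Implicit. Unset Printing Implicit Defensive.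

(** * Words and occurrences of patterns *)

Lemma ler_sum_seq (R : numDomainType) (I : eqType) (r : seq I) (F G : I -> R) :
  {in r, forall i, F i <= G i} -> \sum_(i <- r) F i <= \sum_(i <- r) G i.
Proof. by move=> FG; rewrite big_seq [leRHS]big_seq; apply: ler_sum. Qed.

Section Words.
Variables (T : eqType) (ds : seq T).
Local Notation q := (size ds).

Fixpoint words (m : nat) : seq (seq T) :=
  if m is m'.+1 then [seq d :: u | d <- ds, u <- words m'] else [:: [::]].

Lemma mem_words m u : (u \in words m) = (size u == m) && all (mem ds) u.
Proof.
elim: m u => [|m IH] [|x u] //=.
  by apply/negbTE/negP => /allpairsP[[d v] [_ _]].
rewrite eqSS; apply/allpairsP/idP => [[[d v] /= [dD vw [-> ->]]]|/and3P[su xD uD]].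
  by move: vw; rewrite IH => /andP[-> ->]; rewrite dD.
by exists (x, u); split => //=; rewrite IH su.
Qed.

Lemma size_words m : size (words m) = (q ^ m)%N.
Proof. by elim: m => // m IH; rewrite /= size_allpairs IH expnS. Qed.

Lemma words_uniq m : uniq ds -> uniq (words m).
Proof.
move=> uds; elim: m => // m IH /=.
by apply: allpairs_uniq => // -[d u] [e v] _ _ /= [-> ->].
Qed.

Lemma words_cat_mem m n u v : u \in words m -> v \in words n -> u ++ v \in words (m + n).
Proof.
rewrite !mem_words size_cat all_cat => /andP[/eqP-> ->] /andP[/eqP-> ->].
by rewrite eqxx.
Qed.

Lemma mkseq_words (x : nat -> T) n :
  (forall i, x i \in ds) -> mkseq x n \in words n.
Proof.
move=> xds; rewrite mem_words size_mkseq eqxx /=.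
by apply/allP => _ /mapP[i _ ->] /=.
Qed.

Lemma big_words_cat (V : nmodType) m n (F : seq T -> V) :
  \sum_(w <- words (m + n)) F w =
  \sum_(u <- words m) \sum_(v <- words n) F (u ++ v).
Proof.
elim: m F => [|m IH] F; first by rewrite big_seq1.
rewrite addSn /= !big_allpairs_dep /=.
by apply: eq_bigr => d _; rewrite IH.
Qed.

Hypothesis uds : uniq ds.

Definition occurs (s : seq T) (a : nat) (w : seq T) := take (size s) (drop a w) == s.

Lemma occurs_size s a w : (0 < size s)%N -> occurs s a w -> (a + size s <= size w)%N.
Proof.
move=> s0 /eqP /(congr1 size); rewrite size_take size_drop => E.
by move: E; case: ltnP; lia.
Qed.

Variable R : realFieldType.

Lemma sum_words_const m (c : R) : \sum_(w <- words m) c = q%:R ^+ m * c.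
Proof. by rewrite big_const_seq count_predT size_words iter_addr_0 -[LHS]mulr_natl natrX. Qed.

(** The letters before, at and after the block vary independently. [F] sees only the last part, so
    the count for a later pattern can be nested inside. *)
Lemma sum_occurs s a c (F : seq T -> R) : s \in words (size s) ->
  \sum_(w <- words (a + (size s + c))) (occurs s a w)%:R * F (drop (a + size s) w)
  = q%:R ^+ a * \sum_(v <- words c) F v.
Proof.
move=> sw; rewrite big_words_cat.
rewrite (eq_big_seq (fun=> \sum_(v <- words c) F v)) ?sum_words_const //.
move=> u; rewrite mem_words => /andP[/eqP su _].
rewrite big_words_cat (bigD1_seq s) ?words_uniq //=.
rewrite [X in _ + X]big1_seq ?addr0.
  apply: eq_bigr => v _; rewrite /occurs drop_size_cat // take_size_cat // eqxx mul1r.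
  by rewrite -su -size_cat catA drop_size_cat.
move=> s' /andP[/negbTE ss' s'w]; apply: big1 => v _.
rewrite /occurs drop_size_cat // take_size_cat ?ss' ?mul0r //.
by move: s'w; rewrite mem_words => /andP[/eqP].
Qed.

Lemma count_occurs_fit s a m : s \in words (size s) -> (a + size s <= m)%N ->
  q%:R ^+ size s * \sum_(w <- words m) (occurs s a w)%:R = q%:R ^+ m :> R.
Proof.
move=> sw am; have -> : m = (a + (size s + (m - (a + size s))))%N by lia.
have := sum_occurs a (m - (a + size s)) (fun=> 1) sw.
under eq_bigr do rewrite mulr1.
by move=> ->; rewrite sum_words_const mulr1 !exprD mulrCA.
Qed.

Lemma count_occurs s a m : s \in words (size s) ->
  q%:R ^+ size s * \sum_(w <- words m) (occurs s a w)%:R <= q%:R ^+ m :> R.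
Proof.
move=> sw.
have [s0|s0] := posnP (size s).
  rewrite s0 expr0 mul1r -[leRHS]mulr1 -sum_words_const.
  by apply: ler_sum => w _; case: occurs.
have [am|ma] := leqP (a + size s) m; first by rewrite count_occurs_fit.
rewrite big1_seq ?mulr0 ?exprn_ge0 //.
move=> w /andP[_]; rewrite mem_words => /andP[/eqP wm _].
case E: (occurs _ _ _) => //; have := occurs_size s0 E; rewrite wm; lia.
Qed.

Lemma count_occurs2 s s' a a' m : s \in words (size s) -> s' \in words (size s') ->
  (a + size s <= a')%N ->
  q%:R ^+ size s * (q%:R ^+ size s' *
    \sum_(w <- words m) (occurs s a w && occurs s' a' w)%:R) <= q%:R ^+ m :> R.
Proof.
move=> sw sw' aa'.
have [s0|s0] := posnP (size s').
  rewrite s0 expr0 mul1r; apply: le_trans (count_occurs a m sw).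
  rewrite ler_wpM2l ?exprn_ge0 //; apply: ler_sum => w _.
  by case: (occurs s a w) => //; case: occurs.
have [am|ma] := leqP (a' + size s') m; last first.
  rewrite big1_seq ?mulr0 ?exprn_ge0 //.
  move=> w /andP[_]; rewrite mem_words => /andP[/eqP wm _].
  case E: (occurs s' _ _); rewrite ?andbF //; have := occurs_size s0 E; rewrite wm; lia.
have -> : m = (a + (size s + (m - (a + size s))))%N by lia.
set c := (m - _)%N.
have := sum_occurs a c (fun v => (occurs s' (a' - (a + size s)) v)%:R) sw.
rewrite (eq_bigr (fun w => (occurs s a w && occurs s' a' w)%:R)); last first.
  by move=> w _; rewrite -mulnb natrM /occurs drop_drop subnK.
move=> ->; rewrite 2!exprD; set P := \sum_(v <- _) _.
rewrite (_ : _ * (_ * (_ * P)) =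
  q%:R ^+ a * (q%:R ^+ size s * (q%:R ^+ size s' * P))); last by ring.
rewrite ler_wpM2l ?exprn_ge0 // ler_wpM2l ?exprn_ge0 //.
exact: count_occurs.
Qed.

Variables (d0 d1 : T).
Hypotheses (d0ds : d0 \in ds) (d1ds : d1 \in ds) (d01 : d1 != d0).

Definition pat k := d1 :: nseq k d0.

Lemma size_pat k : size (pat k) = k.+1.
Proof. by rewrite /= size_nseq. Qed.

Lemma pat_words k : pat k \in words (size (pat k)).
Proof. by rewrite mem_words eqxx /= d1ds; apply/allP => x /nseqP[-> _]. Qed.

Lemma nth_pat k i : (0 < i)%N -> nth d0 (pat k) i = d0.
Proof. by case: i => //= i _; rewrite nth_nseq if_same. Qed.

Lemma occurs_nth k a i w : occurs (pat k) a w -> (i <= k)%N ->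
  nth d0 w (a + i) = nth d0 (pat k) i.
Proof. by move=> /eqP E ik; rewrite -nth_drop -E nth_take // size_pat. Qed.

(** The second occurrence would start inside the run of [d0] of the first one, where its first
    letter [d1] cannot stand. *)
Lemma occurs_disjoint k k' a a' w : (a < a' <= a + k)%N ->
  ~~ (occurs (pat k) a w && occurs (pat k') a' w).
Proof.
move=> /andP[aa' a'k]; apply/negP => /andP[oa oa'].
have := occurs_nth oa' (leq0n k'); have := @occurs_nth _ _ (a' - a)%N _ oa.
rewrite addn0 nth_pat ?subn_gt0 // subnKC ?(ltnW aa') // leq_subLR => -> //=.
by apply/eqP; rewrite eq_sym.
Qed.

Let q0 : 0 < q%:R :> R.
Proof. by rewrite ltr0n; case: (ds) d0ds. Qed.

Lemma count_pat k a m :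
  \sum_(w <- words m) (occurs (pat k) a w)%:R <= q%:R ^+ m / q%:R ^+ k.+1 :> R.
Proof.
rewrite ler_pdivlMr ?exprn_gt0 // mulrC -(size_pat k).
exact/count_occurs/pat_words.
Qed.

Lemma count_pat2 k k' a a' m : (a < a')%N ->
  \sum_(w <- words m) (occurs (pat k) a w && occurs (pat k') a' w)%:R
  <= q%:R ^+ m * ((q%:R ^+ k.+1)^-1 * (q%:R ^+ k'.+1)^-1) :> R.
Proof.
move=> aa'; have [ak|ak] := leqP a' (a + k).
  rewrite big1 ?mulr_ge0 ?invr_ge0 ?exprn_ge0 //.
  by move=> w _; rewrite (negbTE (occurs_disjoint _ _ _)) // aa'.
rewrite -invfM ler_pdivlMr ?mulr_gt0 ?exprn_gt0 // mulrC -mulrA.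
rewrite -(size_pat k) -(size_pat k').
by apply: count_occurs2; rewrite ?pat_words // size_pat addnS.
Qed.

(* Chebyshev's inequality: two patterns overlapping in [w] cannot both occur,
   and non-overlapping ones are independent, so the number of occurrences has
   variance at most its mean [s]. *)
Lemma avoid_bound (a k : nat -> nat) (r : seq nat) L :
  {homo a : i j / (i < j)%N} -> uniq r ->
  {in r, forall j, (a j + (k j).+1 <= L)%N} ->
  (\sum_(w <- words L) (all (fun j => ~~ occurs (pat (k j)) (a j) w) r)%:R) *
    (\sum_(j <- r) (q%:R ^+ (k j).+1)^-1) <= q%:R ^+ L :> R.
Proof.
move=> ainc ur fit; set Z := \sum_(w <- _) _.
pose p j : R := (q%:R ^+ (k j).+1)^-1; set s := \sum_(j <- r) _.
have p0 j : 0 < p j by rewrite /p invr_gt0 exprn_gt0.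
have s0 : 0 <= s by apply: sumr_ge0 => j _; exact/ltW/p0.
have := s0; rewrite le_eqVlt => /orP[/eqP<-|{}s0]; first by rewrite mulr0 exprn_ge0 ?ltW.
pose o j w : R := (occurs (pat (k j)) (a j) w)%:R.
pose X w := \sum_(j <- r) o j w.
have count1 j : j \in r -> \sum_(w <- words L) o j w = q%:R ^+ L * p j.
  move=> /fit jL; apply: (canRL (mulfK _)); first by rewrite expf_neq0 ?gt_eqF.
  by rewrite mulrC -(size_pat (k j)) count_occurs_fit ?pat_words ?size_pat.
have sumX : \sum_(w <- words L) X w = q%:R ^+ L * s.
  by rewrite exchange_big /= mulr_sumr; apply: eq_big_seq => j; exact: count1.
(* Second moment: [o] is 0 or 1, so the diagonal contributes the first moment; the other pairs are
   bounded by [count_pat2]. *)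
have sumXX : \sum_(w <- words L) X w ^+ 2 <= q%:R ^+ L * (s ^+ 2 + s).
  rewrite (eq_bigr (fun w => \sum_(i <- r) \sum_(j <- r) o i w * o j w)); last first.
    by move=> w _; rewrite expr2 mulr_suml; apply: eq_bigr => i _; rewrite mulr_sumr.
  rewrite exchange_big /=.
  rewrite mulrDr expr2 mulr_suml !mulr_sumr -big_split /=.
  apply: ler_sum_seq => i ir; rewrite exchange_big /=.
  rewrite (bigD1_seq i) //= addrC lerD //; last first.
    rewrite -count1 //; apply: ler_sum => w _; rewrite /o.
    by case: occurs; rewrite ?mulr1 ?mulr0.
  rewrite mulr_sumr mulr_sumr [leRHS](bigD1_seq i) //= -[leLHS]add0r; apply: lerD; first by rewrite !mulr_ge0 ?exprn_ge0 ?invr_ge0 ?exprn_ge0.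
  apply: ler_sum => j ji; rewrite (eq_bigr (fun w =>
    (occurs (pat (k i)) (a i) w && occurs (pat (k j)) (a j) w)%:R)); last first.
    by move=> w _; rewrite -mulnb natrM.
  case: (ltngtP i j) ji => [ij _|ij _|->] //.
    by apply: count_pat2; exact: ainc.
  rewrite [p i * _]mulrC; under eq_bigr do rewrite andbC.
  by apply: count_pat2; exact: ainc.
(* [X] vanishes on a word avoiding all the patterns, which therefore contributes [s ^+ 2]. *)
have Zle : Z * s ^+ 2 <= \sum_(w <- words L) (X w - s) ^+ 2.
  rewrite mulr_suml; apply: ler_sum => w _.
  case: allP => [h|_]; last by rewrite mul0r sqr_ge0.
  rewrite /X big1_seq; first by rewrite sub0r sqrrN mul1r.
  by move=> j /andP[_ /h]; rewrite /o => /negbTE->.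
have {Zle} : Z * s ^+ 2 <= q%:R ^+ L * s.
  apply: le_trans Zle _.
  rewrite (eq_bigr (fun w => X w ^+ 2 + (X w * (- (2 * s)) + s ^+ 2))); last first.
    by move=> w _; ring.
  rewrite !big_split /= -mulr_suml sum_words_const sumX.
  move: sumXX; set Y := \sum_(w <- _) _; set Q := q%:R ^+ L; nra.
by rewrite expr2 mulrA ler_pM2r.
Qed.

End Words.

(** * Greedy construction of a path avoiding a cover *)

Lemma sum_unique_le (R : numDomainType) (I : eqType) (r : seq I) (P : pred I)
    (F : I -> R) (B : R) : uniq r -> 0 <= B ->
  {in r &, forall x y, P x -> P y -> x = y} -> {in r, forall x, P x -> F x <= B} ->
  \sum_(x <- r | P x) F x <= B.
Proof.
move=> ur B0 Pu PB; have [/hasP[x xr Px]|nP] := boolP (has P r).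
  rewrite big_mkcond (bigD1_seq x) //= Px [X in _ + X]big1_seq ?addr0 ?PB //.
  by move=> y /andP[yx yr]; case: ifP => // Py; rewrite (Pu x y) ?eqxx in yx.
by rewrite big_seq_cond big1 // => x /andP[xr Px]; case/hasP: nP; exists x.
Qed.

(** Gives one stage valid for a whole finite list; it serves to replace an infinite cover by
    finitely many of its families. *)
Lemma seq_monotone_bound (I : eqType) (r : seq I) (P : nat -> I -> Prop) :
  (forall n m x, (n <= m)%N -> P n x -> P m x) ->
  {in r, forall x, exists n, P n x} -> exists n, {in r, forall x, P n x}.
Proof.
move=> Pmono; elim: r => [|x r IH] h; first by exists 0%N.
have [n nP] : exists n, {in r, forall x, P n x}.
  by apply: IH => y yr; apply: h; rewrite in_cons yr orbT.
have [m mP] := h x (mem_head _ _).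
exists (maxn n m) => y; rewrite in_cons => /predU1P[->|/nP].
  by apply: Pmono mP; exact: leq_maxr.
by apply: Pmono; exact: leq_maxl.
Qed.

Lemma prefix_cat2l (T : eqType) (w x y : seq T) :
  prefix (w ++ x) (w ++ y) = prefix x y.
Proof. by rewrite prefix_catr // eqxx. Qed.

Section Greedy.
Variables (T : eqType) (ds : seq T) (R : realFieldType).
Hypothesis uds : uniq ds.
Variables (d0 d1 : T).
Hypotheses (d0ds : d0 \in ds) (d1ds : d1 \in ds) (d01 : d1 != d0).
Local Notation q := (size ds).
Local Notation words := (words ds).
Local Notation pat := (pat d0 d1).

Let q0 : 0 < q%:R :> R.
Proof. by rewrite ltr0n; case: (ds) d0ds. Qed.

Let qn m : 0 < q%:R ^+ m :> R. Proof. by rewrite exprn_gt0. Qed.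

(** [phi n] stands for [f (b ^ -n)], the cost of a cylinder of level [n]; then [g n] is the cost of
    all the cylinders of that level together. *)
Variable phi : nat -> R.
Hypothesis phi_gt0 : forall n, 0 < phi n.
Hypothesis phi_le : forall m n, (m <= n)%N -> phi n <= phi m.
Local Notation g n := (phi n * q%:R ^+ n).
Hypothesis g_le : forall m n, (m <= n)%N -> g m <= g n.
Hypothesis phi_cvg0 : forall e : R, 0 < e -> exists n, phi n < e.
Hypothesis g_unbounded : forall B : R, exists n, B < g n.

Variables (a k : nat -> nat) (act : pred nat).
Hypothesis a_lt : {homo a : i j / (i < j)%N}.
(** Total cost of the words made of [a j] free letters followed by the pattern with run length
    [l]. *)
Local Notation h j l := (q%:R ^+ a j * phi (a j + l.+1)).
Hypothesis div : forall i (B : R), exists n, B <= \sum_(i <= j < n | act j) h j (k j).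

Let phiS n : phi n <= q%:R * phi n.+1.
Proof.
have := g_le (leqnSn n); rewrite exprSr mulrA mulrAC ler_pM2r ?qn //.
by rewrite mulrC.
Qed.

(* Lengthening a run only shrinks the target, so a term of the divergent sum that is
   too large can be cut down. *)
Lemma lengthen_pattern j (s : R) : 0 < s -> exists2 l, (k j <= l)%N &
  (h j l <= q%:R * s) /\ (l = k j \/ s <= h j l).
Proof.
move=> s0; pose P l := (k j <= l)%N && (h j l <= q%:R * s).
have exP : exists l, P l.
  have [n nP] := phi_cvg0 (divr_gt0 (mulr_gt0 q0 s0) (qn (a j))).
  exists (maxn (k j) n); rewrite /P leq_maxl /= mulrC -ler_pdivlMr //.
  apply/ltW/(le_lt_trans _ nP)/phi_le.
  by rewrite (leq_trans (leq_maxr (k j) n)) // addnS leqW // leq_addl.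
case: (ex_minnP exP) => l /andP[kl hl] lmin; exists l => //; split => //.
move: kl; rewrite leq_eqVlt => /predU1P[->|kl]; [by left|right].
case: l kl hl lmin => // l; rewrite ltnS => kl hl lmin.
(* The length just below the minimal one violates the upper bound; by [phiS] one more letter divides
   the term by at most [q]. *)
have : ~~ P l by apply/negP => /lmin; rewrite ltnn.
rewrite /P kl /= -ltNge => /ltW le1; rewrite -(ler_pM2l q0).
apply: le_trans le1 _; rewrite mulrCA ler_pM2l // [in leRHS]addnS; exact: phiS.
Qed.

(** Stop where the sum first reaches [s]: the earlier terms add up to less than [s], and lengthening
    the last run brings its term below [q * s] while keeping the total at least [s]. *)
Lemma choose_range i (s : R) : 0 < s -> exists (r : seq nat) (K : nat -> nat),
  [/\ uniq r, {in r, forall j, act j && (i <= j)%N}, forall j, (k j <= K j)%N &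
      s <= \sum_(j <- r) h j (K j) <= (q%:R + 1) * s].
Proof.
move=> s0; have [m sm] := div i s.
have exP : exists n, s <= \sum_(i <= j < n | act j) h j (k j) by exists m.
case: (ex_minnP exP) => -[|n] sn nmin.
  by move: sn; rewrite big_geq // leNgt s0.
have lt_n : \sum_(i <= j < n | act j) h j (k j) < s.
  by rewrite ltNge; apply/negP => /nmin; rewrite ltnn.
have inn : (i <= n)%N.
  by rewrite leqNgt; apply/negP => ni; move: sn; rewrite big_geq // leNgt s0.
move: sn; rewrite big_mkcond big_nat_recr //= -big_mkcond /=.
have [actn sn|_] := boolP (act n); last by rewrite addr0 leNgt lt_n.
have [l kl [lle lge]] := lengthen_pattern n s0.
pose K j := if j == n then l else k j.
exists [seq j <- index_iota i n.+1 | act j], K; split.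
- by rewrite filter_uniq ?iota_uniq.
- by move=> j; rewrite mem_filter mem_index_iota => /and3P[-> -> _].
- by move=> j; rewrite /K; case: eqP => // ->.
rewrite big_filter big_mkcond big_nat_recr //= -big_mkcond actn /K eqxx /=.
rewrite (_ : \sum_(i <= j < n | act j) _ = \sum_(i <= j < n | act j) h j (k j)); last first.
  rewrite big_nat_cond [RHS]big_nat_cond; apply: eq_bigr => j /andP[/andP[_ jn] _].
  by rewrite ltn_eqF.
apply/andP; split; last by rewrite mulrDl mul1r [leRHS]addrC lerD // ltW.
case: lge => [->//|lge]; apply: le_trans lge _; rewrite lerDr.
by apply: sumr_ge0 => j _; rewrite mulr_ge0 ?ltW.
Qed.

(** [V j] lists the words of the cylinders replacing the [j]-th set of a cover; [Phi N w] is the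
    cost of those of the first [N] families that lie inside the cylinder of [w]. *)
Variable V : nat -> seq (seq T).
Definition Phi N (w : seq T) : R :=
  \sum_(v <- flatten (mkseq V N) | prefix w v) phi (size v).

Lemma Phi_le N N' w : (N <= N')%N -> Phi N w <= Phi N' w.
Proof.
move=> /subnKC <-; rewrite /Phi /mkseq iotaD map_cat flatten_cat big_cat /= lerDl.
by apply: sumr_ge0 => v _; exact: ltW.
Qed.

Section Step.
Variables (n : nat) (w : seq T) (K : nat -> nat) (r : seq nat).
Hypotheses (wn : w \in words n) (ur : uniq r) (nr : {in r, forall j, (n <= a j)%N}).
Local Notation W j := (phi (a j + (K j).+1)).

Let wsize : size w = n.
Proof. by move: wn; rewrite mem_words => /andP[/eqP]. Qed.

(* Discarding the words [u] in which some pattern already occurs makes the hit words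
   pairwise incomparable. *)
Definition fresh u := all (fun i => ~~ occurs (pat (K i)) (a i - n) u) r.
(** A hit [(j, u)] records the pattern closing the word and the free letters [u] between [w] and
    that pattern. *)
Definition hits : seq (nat * seq T) :=
  [seq (j, u) | j <- r, u <- [seq u <- words (a j - n) | fresh u]].
Definition hit_word (p : nat * seq T) := w ++ p.2 ++ pat (K p.1).

Lemma mem_hits p : (p \in hits) = [&& p.1 \in r, p.2 \in words (a p.1 - n) & fresh p.2].
Proof.
case: p => j u; apply/allpairsPdep/idP => [[i [v [ir]]]|/and3P[/= jr uw fu]].
  by rewrite mem_filter => /andP[fv vw] [-> ->]; rewrite ir fv vw.
by exists j, u; rewrite mem_filter fu uw.
Qed.

Lemma hits_uniq : uniq hits.
Proof.
apply: allpairs_uniq_dep => //= [j _|[j u] [i v] _ _ /= [-> ->] //].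
by rewrite filter_uniq ?words_uniq.
Qed.

Lemma size_hit_word p : p \in hits -> size (hit_word p) = (a p.1 + (K p.1).+1)%N.
Proof.
rewrite mem_hits => /and3P[/nr np + _]; rewrite mem_words => /andP[/eqP su _].
by rewrite /hit_word !size_cat wsize su size_pat addnA subnKC.
Qed.

(** Past the end of the word the default value [d0] of [nth] prolongs the run, so the formula holds
    at every later position. *)
Lemma nth_hit_word p i : p \in hits -> (a p.1 <= i)%N ->
  nth d0 (hit_word p) i = if i == a p.1 then d1 else d0.
Proof.
rewrite mem_hits => /and3P[/nr np + _]; rewrite mem_words => /andP[/eqP su _] ai.
rewrite /hit_word catA nth_cat size_cat wsize su subnKC // ltnNge ai /=.
case: eqP => [->|ne]; first by rewrite subnn.
by rewrite nth_pat // subn_gt0 ltn_neqAle ai andbT; apply/eqP => e; case: ne.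
Qed.

Lemma take_hit_word p : p \in hits -> take (a p.1) (hit_word p) = w ++ p.2.
Proof.
rewrite mem_hits => /and3P[/nr np + _]; rewrite mem_words => /andP[/eqP su _].
by rewrite /hit_word catA take_size_cat // size_cat wsize su subnKC.
Qed.

Lemma hits_eq p p' : p \in hits -> p' \in hits -> a p.1 = a p'.1 ->
  take (a p.1) (hit_word p) = take (a p'.1) (hit_word p') -> p = p'.
Proof.
move=> ph ph' aa; rewrite !take_hit_word // => /eqP.
rewrite eqseq_cat // eqxx /= => /eqP.
case: p p' aa {ph ph'} => [j u] [i u'] /= aij ->; congr pair.
by case: (ltngtP j i) => // /a_lt; rewrite aij ltnn.
Qed.

Lemma sum_hits (F : nat * seq T -> R) :
  \sum_(p <- hits) F p = \sum_(j <- r) \sum_(u <- words (a j - n) | fresh u) F (j, u).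
Proof. by rewrite big_allpairs_dep; apply: eq_bigr => j _; rewrite big_filter. Qed.

Local Notation sigma := (\sum_(j <- r) q%:R ^+ a j * W j).

(** By the union bound at most half of the words [u] contain one of the patterns, so at least half
    of them are fresh. *)
Lemma hits_ge : \sum_(j <- r) (q%:R ^+ (K j).+1)^-1 <= 2^-1 :> R ->
  sigma / q%:R ^+ n / 2 <= \sum_(p <- hits) W p.1.
Proof.
move=> small; rewrite sum_hits !mulr_suml; apply: ler_sum_seq => j jr /=.
have e0 : q%:R ^+ a j = q%:R ^+ (a j - n) * q%:R ^+ n :> R.
  by rewrite -exprD subnK // nr.
rewrite e0 [_ * W j]mulrAC mulfK ?gt_eqF // [_ * W j]mulrC -mulrA.
rewrite -big_filter big_const_seq count_predT iter_addr_0 -[leRHS]mulr_natr.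
rewrite ler_pM2l // size_filter.
rewrite (_ : (count _ _)%:R = \sum_(u <- words (a j - n)) (fresh u)%:R); last first.
  by rewrite -sum1_count natr_sum big_mkcond; apply: eq_bigr => u _; case: fresh.
have le1 : \sum_(u <- words (a j - n)) (~~ fresh u)%:R <= q%:R ^+ (a j - n) / 2 :> R.
  apply: (@le_trans _ _ (\sum_(u <- words (a j - n)) \sum_(i <- r)
      (occurs (pat (K i)) (a i - n) u)%:R)).
    apply: ler_sum => u _; rewrite -has_predC; case: hasP => [[i ir]|_]; last first.
      exact: sumr_ge0.
    by move=> /= /negPn o; rewrite (bigD1_seq i) //= o lerDl sumr_ge0.
  rewrite exchange_big /=; apply: le_trans (_ : _ <= q%:R ^+ (a j - n) *
     \sum_(i <- r) (q%:R ^+ (K i).+1)^-1) _; last by rewrite ler_pM2l.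
  rewrite mulr_sumr; apply: ler_sum => i _; exact: count_pat.
have : \sum_(u <- words (a j - n)) ((fresh u)%:R + (~~ fresh u)%:R) = q%:R ^+ (a j - n) :> R.
  rewrite -[RHS]mulr1 -sum_words_const; apply: eq_bigr => u _.
  by case: fresh; rewrite ?addr0 ?add0r.
rewrite big_split /=; set A := \sum_(u <- _) (fresh u)%:R; move: le1; lra.
Qed.

(** Let two hit words be prefixes of [v]. With equal positions [a] they agree. If the later pattern
    starts inside the run of the earlier one, [d1] meets [d0]. If it starts after it, the earlier
    pattern occurs in the free letters of the later hit, against freshness. *)
Lemma hits_antichain v : \sum_(p <- hits | prefix (hit_word p) v) 1 <= 1 :> R.
Proof.
apply: sum_unique_le => //; first exact: hits_uniq.
move=> p p' ph ph'; wlog: p p' ph ph' / (a p.1 <= a p'.1)%N.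
  by case: (leqP (a p.1) (a p'.1)) => [le H|/ltnW le H] ? ?; [|symmetry]; apply: H.
move=> le pv p'v.
have tv x : prefix x v -> x = take (size x) v by rewrite prefixE => /eqP->.
have ep := tv _ pv; have ep' := tv _ p'v; rewrite size_hit_word // in ep.
rewrite size_hit_word // in ep'.
move: le; rewrite leq_eqVlt => /orP[/eqP aa|aa].
  apply: hits_eq => //; rewrite ep ep' aa !take_takel //; exact: leq_addr.
have [lt|ge] := leqP (a p'.1) (a p.1 + K p.1).
  have := nth_hit_word ph (ltnW aa); have := nth_hit_word ph' (leqnn _).
  rewrite eqxx gtn_eqF // ep ep' !nth_take; last first.
  - by rewrite -addSnnS leq_addr.
  - by rewrite addnS ltnS.
  by move=> -> /eqP; rewrite (negbTE d01).
have : occurs (pat (K p.1)) (a p.1 - n) p'.2.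
  have := take_hit_word ph'; rewrite ep' take_takel ?leq_addr // => tw.
  have : prefix (hit_word p) (take (a p'.1) v).
    rewrite prefixE take_takel ?size_hit_word //; first by rewrite -ep.
    by rewrite addnS.
  rewrite tw /hit_word prefix_cat2l => /prefixP[y yE].
  move: ph; rewrite mem_hits => /and3P[_ + _]; rewrite mem_words => /andP[/eqP su _].
  by rewrite /occurs yE -catA drop_size_cat // take_size_cat.
move: ph'; rewrite mem_hits => /and3P[_ _ /allP f]; move: ph; rewrite mem_hits.
by move=> /and3P[/f/negbTE-> _ _].
Qed.

Lemma count_prefix y m : (size y <= m)%N ->
  \sum_(u <- words m) (prefix y u)%:R <= q%:R ^+ m / q%:R ^+ size y :> R.
Proof.
move=> ym; rewrite ler_pdivlMr // mulrC.
have [yw|yw] := boolP (y \in words (size y)).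
  apply: le_trans (count_occurs uds R 0 m yw).
  by rewrite ler_pM2l //; apply: ler_sum => u _; rewrite /occurs drop0 prefixE.
rewrite big1_seq ?mulr0 ?exprn_ge0 // => u /andP[_]; case: prefixP => // -[z ->].
rewrite mem_words all_cat => /and3P[_ yd _].
by case/negP: yw; rewrite mem_words eqxx.
Qed.

(** If [v] ends before the closing pattern starts, it fixes [size v] of the first [a j] letters,
    which divides the available weight by [q ^ size v]. If it reaches into the pattern, the place of
    [d1] is visible in [v] and determines the hit, whose weight is at most [phi (size v)]. *)
Lemma hits_below v : prefix w v ->
  \sum_(p <- hits | prefix v (hit_word p)) W p.1
    <= sigma / q%:R ^+ size v + phi (size v).
Proof.
case/prefixP => y ->; set l := size (w ++ y).
rewrite (bigID (fun p : nat * seq T => (l <= a p.1)%N)) /= lerD //.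
  rewrite big_mkcond /=.
  apply: (@le_trans _ _ (\sum_(p <- hits) ((l <= a p.1)%N && prefix y p.2)%:R * W p.1)).
    apply: ler_sum_seq => p ph; case: ifP => [/andP[pv lp]|_]; last first.
      by rewrite mulr_ge0 // ltW.
    rewrite lp /=; move: pv; rewrite /hit_word prefix_cat2l => pv.
    suff -> : prefix y p.2 by rewrite mul1r.
    move: ph pv; rewrite mem_hits !prefixE => /and3P[_ + _].
    rewrite mem_words => /andP[/eqP su _]; rewrite take_cat.
    case: ltnP => // le; suff -> : size y = size p.2 by rewrite subnn take0 cats0 take_size.
    by move: lp le; rewrite /l size_cat wsize su; move: (a p.1) (size y) => A B; lia.
  rewrite sum_hits mulr_suml; apply: ler_sum => j _ /=.
  rewrite big_mkcond.
  apply: (@le_trans _ _ (\sum_(u <- words (a j - n)) ((l <= a j)%N && prefix y u)%:R * W j)).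
    by apply: ler_sum => u _; case: ifP => // _; rewrite mulr_ge0 // ltW.
  rewrite -mulr_suml mulrAC ler_pM2r //.
  have [lj|_] := leqP l (a j); last first.
    by rewrite big1 ?mulr_ge0 ?invr_ge0 ?exprn_ge0 // ltW.
  have lyn : l = (n + size y)%N by rewrite /l size_cat wsize.
  have nj : (n <= a j)%N by rewrite (leq_trans _ lj) // lyn leq_addr.
  apply: le_trans (count_prefix _) _; first by rewrite leq_subRL // -lyn.
  by rewrite lyn addnC exprD -{2}(subnK nj) exprD invfM mulrACA mulfV ?gt_eqF // mulr1.
apply: sum_unique_le; [exact: hits_uniq | exact: ltW | | ]; last first.
  move=> p ph /andP[pv lp]; apply: phi_le; rewrite -(size_hit_word ph).
  by case/prefixP: pv => z ->; rewrite size_cat leq_addr.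
move=> p p' ph ph'; wlog: p p' ph ph' / (a p.1 <= a p'.1)%N.
  by case: (leqP (a p.1) (a p'.1)) => [le H|/ltnW le H] ? ?; [|symmetry]; apply: H.
move=> le /andP[pv]; rewrite -ltnNge => lp /andP[p'v]; rewrite -ltnNge => lp'.
have tv x i : prefix (w ++ y) x -> (i <= l)%N -> take i x = take i (w ++ y).
  by case/prefixP=> z -> il; rewrite takel_cat.
have nv x i : prefix (w ++ y) x -> (i < l)%N -> nth d0 x i = nth d0 (w ++ y) i.
  by case/prefixP=> z -> il; rewrite nth_cat il.
move: le; rewrite leq_eqVlt => /orP[/eqP aa|aa].
  by apply: hits_eq => //; rewrite !tv ?aa // ltnW.
have := nth_hit_word ph (ltnW aa); have := nth_hit_word ph' (leqnn _).
by rewrite eqxx gtn_eqF // !nv // => -> /eqP; rewrite (negbTE d01).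
Qed.

Lemma prefix_total (x y z : seq T) : prefix x z -> prefix y z -> prefix x y || prefix y x.
Proof.
rewrite !prefixE => /eqP xz /eqP yz.
case/orP: (leq_total (size x) (size y)) => le; apply/orP; [left|right]; apply/eqP.
  by have := take_takel z le; rewrite yz xz.
by have := take_takel z le; rewrite xz yz.
Qed.

(* If every hit word were bad, that is, below an element of the cover or carrying too
   much of its cost, the total weight [sigma] of the hits could be charged to the cost of
   the cover below [w], which is too small for that. *)
Lemma exists_good_hit c B :
  0 < c -> sigma <= B * g n -> (1 + B) * c <= 4^-1 -> 3 * g n <= sigma ->
  \sum_(j <- r) (q%:R ^+ (K j).+1)^-1 <= 2^-1 :> R ->
  (forall N, Phi N w <= c * phi n) ->
  exists2 p, p \in hits &
    (forall N, Phi N (hit_word p) <= c * phi (size (hit_word p))) /\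
    (forall j v, v \in V j -> prefix w v -> ~~ prefix v (hit_word p)).
Proof.
move=> c0 sB Bc s3 small good; apply: contrapT => none.
have bad : {in hits, forall p, exists N, c * W p.1 < Phi N (hit_word p) \/
    has (fun v => prefix w v && prefix v (hit_word p)) (flatten (mkseq V N))}.
  move=> p ph; apply: contrapT => nbad; apply: none; exists p => //; split.
    move=> N; rewrite size_hit_word // leNgt; apply/negP => lt.
    by apply: nbad; exists N; left.
  move=> j v vj wv; apply/negP => pv; apply: nbad; exists j.+1; right.
  apply/hasP; exists v; last by rewrite wv pv.
  by apply/flattenP; exists (V j) => //; apply: map_f; rewrite mem_iota add0n ltnSn.
(* Badness of a hit is detected at a finite stage and there are finitely many hits, so one [N]
   serves for all. *)
have [|N NP] := seq_monotone_bound _ bad.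
  move=> N N' p NN' [lt|/hasP[v vN vP]]; [left|right].
    by apply: lt_le_trans lt _; exact: Phi_le.
  apply/hasP; exists v => //; move: vN; rewrite -(subnKC NN') /mkseq iotaD map_cat.
  by rewrite flatten_cat mem_cat => ->.
set VV := flatten (mkseq V N) in NP.
have gn0 m : 0 < g m by rewrite mulr_gt0.
have B0 : 0 <= B.
  rewrite -(pmulr_lge0 _ (gn0 n)); apply: le_trans sB.
  by apply: le_trans s3; rewrite mulr_ge0 // ltW.
(* Double counting over pairs of a hit and a cover element. An element [v] below [w] is charged
   [c^-1 * phi (size v)] by the at most one hit word above it, and [(B + 1) * phi (size v)] by the
   hit words below it, since [sigma <= B * g n <= B * g (size v)]. *)
have up : \sum_(p <- hits) W p.1 <= (c^-1 + (B + 1)) * Phi N w.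
  apply: (@le_trans _ _ (\sum_(p <- hits) \sum_(v <- VV)
     (c^-1 * phi (size v) * (prefix (hit_word p) v)%:R +
      (prefix w v)%:R * ((prefix v (hit_word p))%:R * W p.1)))).
    apply: ler_sum_seq => p ph; rewrite big_split /=.
    have s1 : \sum_(v <- VV) c^-1 * phi (size v) * (prefix (hit_word p) v)%:R =
              c^-1 * Phi N (hit_word p).
      rewrite mulr_sumr [RHS]big_mkcond; apply: eq_bigr => v _.
      by case: prefix; rewrite ?mulr1 ?mulr0.
    have s2 : 0 <= \sum_(v <- VV) (prefix w v)%:R * ((prefix v (hit_word p))%:R * W p.1).
      by apply: sumr_ge0 => v _; rewrite !mulr_ge0 // ltW.
    have s3' : 0 <= Phi N (hit_word p) by apply: sumr_ge0 => v _; exact: ltW.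
    case: (NP p ph) => [lt|/hasP[v vV /andP[wv vp]]].
      by rewrite s1 -[leLHS]addr0 lerD // mulrC ler_pdivlMr // mulrC ltW.
    rewrite s1 -[leLHS]add0r lerD //; first by rewrite mulr_ge0 // invr_ge0 ltW.
    rewrite (big_rem v) //= wv vp !mul1r lerDl.
    by apply: sumr_ge0 => u _; rewrite !mulr_ge0 // ltW.
  rewrite exchange_big /= mulr_sumr [leRHS]big_mkcond; apply: ler_sum => v _.
  case: ifP => wv; last first.
    rewrite big1 // => p _; rewrite mul0r addr0.
    case: prefixP => [[z vE]|]; last by rewrite mulr0.
    by move: wv; rewrite vE /hit_word -!catA prefix_prefix.
  rewrite big_split /= mulrDl lerD //.
    rewrite -mulr_sumr -[leRHS]mulr1 ler_wpM2l ?mulr_ge0 ?invr_ge0 //; try exact: ltW.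
    apply: le_trans (hits_antichain v); rewrite [leRHS]big_mkcond.
    by apply: ler_sum => p _; case: prefix.
  apply: (@le_trans _ _ (sigma / q%:R ^+ size v + phi (size v))).
    apply: le_trans (hits_below wv); rewrite [leRHS]big_mkcond /=.
    by apply: ler_sum => p _; rewrite mul1r; case: prefix; rewrite ?mul1r ?mul0r.
  rewrite mulrDl mul1r lerD2r ler_pdivrMr // -mulrA.
  apply: le_trans sB _; apply: ler_wpM2l => //; apply: g_le.
  by case/prefixP: wv => z ->; rewrite size_cat wsize leq_addr.
have low := hits_ge small.
have : sigma / q%:R ^+ n / 2 <= (c^-1 + (B + 1)) * (c * phi n).
  apply: le_trans low (le_trans up _); apply: ler_wpM2l (good N).
  by rewrite addr_ge0 ?addr_ge0 // invr_ge0 ltW.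
(* The left side is at least 3/2 times [phi n], while [(1 + B) * c <= 1/4] makes the right side at
   most 5/4 times [phi n]. *)
have : 3 * phi n <= sigma / q%:R ^+ n by rewrite ler_pdivlMr // -mulrA.
set s := sigma / _; have -> : (c^-1 + (B + 1)) * (c * phi n) = (1 + (1 + B) * c) * phi n.
  by rewrite mulrA mulrDl mulVf ?gt_eqF // [B + 1]addrC.
have := phi_gt0 n; move: Bc; set x := (1 + B) * c; set f := phi n; nra.
Qed.

End Step.

Hypothesis a_ge : forall j, (j <= a j)%N.

(** Solves [(1 + B) * cst = 1/4] for [B = (q + 1) * 3]: 3 is the multiple of [g] asked of [sigma],
    and [q + 1] the loss in [choose_range]. *)
Let cst : R := (4 * (1 + (q%:R + 1) * 3))^-1.

Let cst_lt1 : cst < 1.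
Proof. by rewrite /cst invf_lt1; move: q0; lra. Qed.

Lemma greedy_step w i : w \in words (size w) ->
  (forall N, Phi N w <= cst * phi (size w)) ->
  exists w' j l, [/\ w' \in words (size w'), drop (a j) w' = pat l,
    [&& act j, (i <= j)%N & (k j <= l)%N] & prefix w w' /\
    (forall N, Phi N w' <= cst * phi (size w')) /\
    (forall j v, v \in V j -> prefix w v -> ~~ prefix v w')].
Proof.
move=> ww good; pose B : R := (q%:R + 1) * 3.
have B0 : 0 <= B by rewrite mulr_ge0 // addr_ge0.
have g0 m : 0 < g m by rewrite mulr_gt0.
have c0 : 0 < cst by rewrite invr_gt0 mulr_gt0 // ltr_wpDr.
(* Since [h j l = g (a j + l.+1) / q ^ l.+1], a value [g n0] above twice the bound on the sum of the
   [h] forces the sum of the [1 / q ^ (K j).+1] below 1/2 for indices beyond [n0]. *)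
have [n0 n0P] := g_unbounded (2 * (B * g (size w))).
pose i' := maxn i (maxn n0 (size w)).
have [r [K [ur rP kK /andP[sge sle]]]] := choose_range i' (mulr_gt0 (ltr0n R 3) (g0 (size w))).
have [ii' n0i' wi'] : [/\ (i <= i')%N, (n0 <= i')%N & (size w <= i')%N].
  by rewrite /i' !leq_max !leqnn !orbT.
have nr : {in r, forall j, (size w <= a j)%N}.
  by move=> j /rP/andP[_ i'j]; apply: leq_trans (a_ge j); exact: leq_trans i'j.
have sB : \sum_(j <- r) h j (K j) <= B * g (size w) by rewrite /B -mulrA.
have small : \sum_(j <- r) (q%:R ^+ (K j).+1)^-1 <= 2^-1 :> R.
  rewrite -(ler_pM2r (g0 n0)); apply: (@le_trans _ _ (\sum_(j <- r) h j (K j))).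
    rewrite mulr_suml; apply: ler_sum_seq => j /rP/andP[_ i'j].
    rewrite mulrC ler_pdivrMr //; apply: (@le_trans _ _ (g (a j + (K j).+1))).
      apply: g_le; apply: leq_trans n0i' (leq_trans i'j (leq_trans (a_ge j) _)).
      exact: leq_addr.
    by rewrite exprD mulrCA mulrA.
  by move: sB n0P; lra.
have [] := exists_good_hit ww ur nr c0 sB _ sge small good.
  rewrite /cst -/B invfM mulrCA mulfV ?mulr1 // gt_eqF //.
  by rewrite ltr_pwDl.
move=> p ph [good' clean'].
exists (hit_word w K p), p.1, (K p.1).
have := ph; rewrite mem_hits => /and3P[pr pw _].
have e : (size w + (a p.1 - size w) = a p.1)%N by rewrite subnKC // nr.
split; last (split; [exact: prefix_prefix|by []]).
- have := words_cat_mem ww (words_cat_mem pw (pat_words d0ds d1ds (K p.1))).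
  by rewrite /hit_word !mem_words => /andP[_ ->]; rewrite eqxx.
- rewrite /hit_word catA drop_size_cat // size_cat.
  by move: pw; rewrite mem_words => /andP[/eqP-> _].
- by have /andP[-> i'j] := rP _ pr; rewrite kK (leq_trans ii').
Qed.

(** The nested words obtained by iterating [greedy_step] converge to [x]. The invariant also says
    that no cover element is a prefix of the current word; this passes to [x], whose prefixes are
    prefixes of the words [W m]. *)
Lemma greedy_path w0 : w0 \in words (size w0) ->
  (forall N, Phi N w0 <= cst * phi (size w0)) ->
  (forall j v, v \in V j -> ~~ prefix v w0) ->
  exists x : nat -> T, [/\ forall i, x i \in ds,
    forall j v, v \in V j -> v <> mkseq x (size v) &
    forall i, exists j, [/\ act j, (i <= j)%N &
      forall t, (t < k j)%N -> x (a j + t.+1)%N = d0]].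
Proof.
move=> w0w w0good w0clean.
pose inv w := [/\ w \in words (size w), forall N, Phi N w <= cst * phi (size w) &
  forall j v, v \in V j -> ~~ prefix v w].
have [|f fP] := @choice (nat * seq T) (seq T) (fun iw w' => inv iw.2 ->
    [/\ inv w', prefix iw.2 w' & exists j l,
      [/\ drop (a j) w' = pat l, act j, (iw.1 <= j)%N & (k j <= l)%N]]).
  move=> [i w] /=; have [[ww wgood wclean]|ninv] := pselect (inv w); last by exists w.
  have [w' [j [l [w'w dw' /and3P[actj ij kl] [ww' [w'good w'clean]]]]]] :=
    greedy_step i ww wgood.
  exists w' => _; split=> //; last by exists j, l; split.
  (* A cover element that is a prefix of [w'] is comparable with [w]: a prefix of [w] is excluded by
     the invariant, an extension of [w] by the step. *)
  split=> // j' v vj; apply/negP => vw'; case/orP: (prefix_total vw' ww').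
    by apply/negP; exact: (wclean _ _ vj).
  by move=> wv; have := w'clean _ _ vj wv; rewrite vw'.
pose W := fix W i := if i is i'.+1 then f (i', W i') else w0.
have Winv i : inv (W i) by elim: i => //= i /(fP (i, W i))[].
have Wpre i m : prefix (W i) (W (i + m)%N).
  elim: m => [|m IH]; first by rewrite addn0 prefix_refl.
  by rewrite addnS; apply: prefix_trans IH _; case: (fP (i + m, W (i + m))%N (Winv (i + m)%N)).
have Whit i : exists j l, [/\ drop (a j) (W i.+1) = pat l, act j, (i <= j)%N & (k j <= l)%N].
  by case: (fP (i, W i) (Winv i)).
have Wsize i : (i < size (W i.+1))%N.
  have [j [l [dj _ ij _]]] := Whit i; have := congr1 size dj.
  rewrite size_drop size_pat => E; apply: leq_ltn_trans (leq_trans ij (a_ge j)) _.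
  by rewrite -subn_gt0 E.
pose x i := nth d0 (W i.+1) i.
have xW m i : (i < size (W m))%N -> nth d0 (W m) i = x i.
  move=> im; rewrite /x; case/orP: (leq_total m i.+1) => le.
    by have /prefixP[z] := Wpre m (i.+1 - m)%N; rewrite subnKC // => ->; rewrite nth_cat im.
  by have /prefixP[z] := Wpre i.+1 (m - i.+1)%N; rewrite subnKC // => ->; rewrite nth_cat Wsize.
have xtake m l : (l <= size (W m))%N -> mkseq x l = take l (W m).
  move=> lm; apply: (@eq_from_nth _ d0); first by rewrite size_mkseq size_takel.
  move=> i; rewrite size_mkseq => il; rewrite nth_mkseq // nth_take // xW //.
  exact: leq_trans lm.
exists x; split.
- move=> i; have [+ _ _] := Winv i.+1; rewrite mem_words => /andP[_ /allP]; apply.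
  exact: mem_nth.
- move=> j v vj vE; have [_ _ clean] := Winv (size v).+1.
  have /negP := clean _ _ vj; apply.
  by rewrite prefixE -xtake -?vE //; exact: ltnW (Wsize _).
- move=> i; have [j [l [dj actj ij kl]]] := Whit i; exists j; split => // t tk.
  have tl : (t.+1 < size (pat l))%N by rewrite size_pat ltnS (leq_trans tk).
  have sz : (a j + t.+1 < size (W i.+1))%N by rewrite -ltn_subRL -size_drop dj.
  by rewrite -(xW i.+1) // -nth_drop dj nth_pat.
Qed.

(** If every word of length [n0] had too much cost below it, the sum over these words would exceed
    the cost of the whole cover. Cover elements have length at least [n0], so only [w] itself could
    be a prefix of [w], and its own cost would break the bound because [cst < 1]. *)
Lemma greedy_start n0 B : B < cst * g n0 ->
  (forall j v, v \in V j -> (n0 <= size v)%N) ->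
  (forall N, \sum_(v <- flatten (mkseq V N)) phi (size v) <= B) ->
  exists x : nat -> T, [/\ forall i, x i \in ds,
    forall j v, v \in V j -> v <> mkseq x (size v) &
    forall i, exists j, [/\ act j, (i <= j)%N &
      forall t, (t < k j)%N -> x (a j + t.+1)%N = d0]].
Proof.
move=> Blt Vsize VB.
suff [w ww wgood] : exists2 w, w \in words n0 & forall N, Phi N w <= cst * phi (size w).
  move: (ww); rewrite mem_words => /andP[/eqP sw wds].
  apply: (@greedy_path w) => //; first by rewrite sw.
  move=> j v vj; apply/negP => vw.
  have vE : v = w.
    by move: vw; rewrite prefixE take_oversize ?sw ?(Vsize _ _ vj) // => /eqP.
  have := wgood j.+1; apply/negP; rewrite -ltNge.
  apply: (@lt_le_trans _ _ (phi (size w))).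
    by rewrite gtr_pMl // cst_lt1.
  rewrite /Phi /mkseq -addn1 iotaD map_cat flatten_cat big_cat /= cats0 add0n.
  rewrite -[leLHS]add0r lerD //; first by apply: sumr_ge0 => ? _; exact: ltW.
  rewrite vE in vj; rewrite (big_rem w) //= prefix_refl lerDl.
  by apply: sumr_ge0 => ? _; exact: ltW.
apply: contrapT => none.
have [||N NP] := @seq_monotone_bound _ (words n0) (fun N w => cst * phi n0 < Phi N w).
- by move=> N N' w NN' lt; apply: lt_le_trans lt _; exact: Phi_le.
- move=> w ww; apply: contrapT => wgood; apply: none; exists w => // N.
  move: ww; rewrite mem_words => /andP[/eqP -> _].
  by rewrite leNgt; apply/negP => lt; apply: wgood; exists N.
have := VB N; apply/negP; rewrite -ltNge; apply: lt_le_trans Blt _.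
apply: (@le_trans _ _ (\sum_(w <- words n0) Phi N w)).
  rewrite mulrA mulrC -sum_words_const; apply: ler_sum_seq => w ww; exact/ltW/NP.
rewrite /Phi (exchange_big_dep xpredT) //=; apply: ler_sum => v _.
rewrite -[leRHS]mulr1; under eq_bigr do rewrite -[phi _]mulr1.
rewrite -mulr_sumr ler_pM2l //; apply: sum_unique_le => //; first exact: words_uniq.
move=> w w'; rewrite !mem_words !prefixE => /andP[/eqP-> _] /andP[/eqP-> _].
by move=> /eqP-> /eqP->.
Qed.
End Greedy.

(** * Hausdorff measures *)

Section Hausdorff.
Variables (R : realType) (f : R -> R).
Hypothesis f_gt0 : forall r : R, 0 < r -> 0 < f r.
Hypothesis f_le : forall r s : R, 0 < r -> r <= s -> f r <= f s.

Lemma diam_le (U : set R) (r : R) :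
  (forall x y, U x -> U y -> `|x - y| <= r) -> (diam U <= r%:E)%E.
Proof.
by move=> Ur; apply: ge_ereal_sup => _ [x Ux [y Uy <-]]; rewrite lee_fin Ur.
Qed.

Lemma le_diam (U : set R) x y : U x -> U y -> (`|x - y|%:E <= diam U)%E.
Proof. by move=> Ux Uy; apply: ereal_sup_ubound; exists x => //; exists y. Qed.

Lemma hcost_ge0 (U : set R) : (0 <= hcost f U)%E.
Proof.
rewrite /hcost; case: (diam U) => [r| |] //.
by case: ifP => // r0; rewrite lee_fin ltW // f_gt0.
Qed.

Lemma hcost_le (U : set R) (r : R) : 0 < r ->
  (forall x y, U x -> U y -> `|x - y| <= r) -> (hcost f U <= (f r)%:E)%E.
Proof.
move=> r0 /diam_le; rewrite /hcost; case: (diam U) => [s| |] //; last first.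
  by rewrite lee_fin => _; exact/ltW/f_gt0.
by rewrite lee_fin => sr; case: ifP => s0; rewrite lee_fin; [exact: f_le|exact/ltW/f_gt0].
Qed.

Lemma diam0 : diam (set0 : set R) = -oo%E.
Proof.
rewrite /diam (_ : [set _ | _ in _ & _ in _] = set0) ?ereal_sup0 //.
by apply/seteqP; split=> // ? [].
Qed.

Lemma hcost0 : hcost f set0 = 0%E.
Proof. by rewrite /hcost diam0. Qed.

Lemma hausdorff_delta_ge0 d (E : set R) : (0 <= hausdorff_delta f d E)%E.
Proof.
by apply: le_ereal_inf_tmp => _ [U _ <-]; apply: nneseries_ge0 => ? _ _; exact: hcost_ge0.
Qed.

Lemma hausdorff_delta_subset d (E F : set R) : E `<=` F ->
  (hausdorff_delta f d E <= hausdorff_delta f d F)%E.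
Proof.
move=> EF; apply: ereal_inf_le_tmp => _ [U [FU Ud] <-]; exists U => //; split => //.
exact: subset_trans FU.
Qed.

Lemma hausdorff_delta_seq d (E : set R) (s : seq (set R)) :
  (forall x, E x -> exists2 U, U \in s & U x) ->
  (forall U, U \in s -> (diam U <= d%:E)%E) ->
  (hausdorff_delta f d E <= \sum_(U <- s) hcost f U)%E.
Proof.
move=> Es sd; apply: ereal_inf_lbound; exists (nth set0 s).
  split=> [x /Es[U Us Ux]|i].
    by exists (index U s) => //; rewrite nth_index.
  by case: (ltnP i (size s)) => si; [apply/sd/mem_nth|rewrite nth_default // diam0 leNye].
rewrite (nneseries_split _ (size s)) => [|? _]; last exact: hcost_ge0.
rewrite add0n (big_nth set0) [X in (_ + X)%E]eseries0 ?adde0 //.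
by move=> i si _; rewrite nth_default // hcost0.
Qed.

(** The strict bounds provide a cover of each [E i]; a bijection between [nat] and [nat * nat]
    merges them into one cover whose cost is a double sum. *)
Lemma hausdorff_delta_bigcup d (E : nat -> set R) (c : nat -> \bar R) :
  (forall i, hausdorff_delta f d (E i) < c i)%E ->
  (hausdorff_delta f d (\bigcup_i E i) <= \sum_(i <oo) c i)%E.
Proof.
move=> Ec.
have [G GP] : {G : nat -> nat -> set R & forall i,
    [/\ E i `<=` \bigcup_j G i j, forall j, (diam (G i j) <= d%:E)%E &
      (\sum_(j <oo) hcost f (G i j) < c i)%E]}.
  apply: (@choice _ _ (fun i U => [/\ E i `<=` \bigcup_j U j,
    forall j, (diam (U j) <= d%:E)%E & (\sum_(j <oo) hcost f (U j) < c i)%E])).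
  by move=> i; have /ereal_inf_lt [_ [U [EU Ud] <-] Uc] := Ec i; exists U.
have /card_esym/ppcard_eqP[e] := card_nat2.
apply: (@le_trans _ _ (\sum_(k <oo) hcost f (G (e k).1 (e k).2))%E).
  apply: ereal_inf_lbound; exists (fun k => G (e k).1 (e k).2) => //.
  split=> [x [i _ Ex]|k].
    have [/(_ _ Ex) [j _ Gx] _ _] := GP i; exists (e^-1%FUN (i, j)) => //=.
    by rewrite invK ?inE.
  by have [_ + _] := GP (e k).1; apply.
rewrite nneseries_esumT; last by move=> ?; exact: hcost_ge0.
rewrite -(@reindex_esum _ _ _ setT setT e (fun p => hcost f (G p.1 p.2))); last first.
  by [].
have -> : [set: nat * nat] = setT `*`` (fun=> setT) by apply/seteqP; split.
rewrite -(esum_esum (fun i j _ _ => hcost_ge0 (G i j))).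
rewrite -nneseries_esumT; last by move=> i; apply: esum_ge0 => ? _; exact: hcost_ge0.
apply: lee_nneseries => [i *|i *]; first by apply: esum_ge0 => ? _; exact: hcost_ge0.
rewrite -nneseries_esumT; last by move=> ?; exact: hcost_ge0.
by have [_ _ /ltW] := GP i.
Qed.

End Hausdorff.

(** * Expansions in base b *)

Section Coding.
Variables (R : realType) (b : nat).
Hypothesis b2 : (2 <= b)%N.
Implicit Types (x y : nat -> 'I_b) (X Y : R) (w : seq 'I_b).

Let bR0 : 0 < b%:R :> R. Proof. by rewrite ltr0n; lia. Qed.
Let bR1 : 0 < b%:R - 1 :> R. Proof. by rewrite subr_gt0 ltr1n. Qed.
Let bn n : 0 < b%:R ^+ n :> R. Proof. by rewrite exprn_gt0. Qed.

Definition digits_sum x : nat -> R := series (fun n => (nat_of_ord (x n))%:R / b%:R ^+ n.+1).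
Definition codes x X := digits_sum x @ \oo --> X.

Definition wval w : nat := foldl (fun v d => (b * v + nat_of_ord d)%N) 0%N w.

Lemma wval_rcons w d : wval (rcons w d) = (b * wval w + d)%N.
Proof. by rewrite /wval foldl_rcons. Qed.

Lemma wval_inj n : {in [pred w | size w == n] &, injective wval}.
Proof.
elim: n => [|n IH] w w'; first by rewrite !inE !size_eq0 => /eqP-> /eqP->.
case/lastP: w => [|w d] //; case/lastP: w' => [|w' d'] //.
rewrite !inE !size_rcons !eqSS => sw sw'; rewrite !wval_rcons => E.
have dd : nat_of_ord d = d'.
  have := congr1 (modn^~ b) E; rewrite /= ![(b * _)%N]mulnC !modnMDl.
  by rewrite !modn_small.
rewrite (ord_inj dd); congr rcons; apply: IH; rewrite ?inE //.
by move: E; rewrite dd => /addIn /eqP; rewrite eqn_pmul2l; [move=> /eqP|exact: ltnW].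
Qed.

Lemma digits_sum_wval x n : digits_sum x n = (wval (mkseq x n))%:R / b%:R ^+ n.
Proof.
elim: n => [|n IH]; first by rewrite /digits_sum seriesEnat /= big_geq // mul0r.
rewrite mkseqS wval_rcons /digits_sum seriesSr -/(digits_sum x n) IH.
rewrite natrD natrM exprS mulrDl -mulf_div divff ?gt_eqF // mul1r.
by rewrite -exprS.
Qed.

(* The value obtained from the first [j] digits followed by the constant digit [l]. *)
Let tail x l j : R := digits_sum x j + l%:R / ((b%:R - 1) * b%:R ^+ j).

Let tailS x l j : tail x l j.+1 = tail x l j + ((x j)%:R - l%:R) / b%:R ^+ j.+1.
Proof.
rewrite /tail /digits_sum seriesSr -!addrA; congr +%R.
by rewrite exprS; field; rewrite !gt_eqF.
Qed.

Let cvg_tail x l X : codes x X -> tail x l @ \oo --> X.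
Proof.
move=> xX; rewrite -[X]addr0; apply: cvgD => //.
rewrite (_ : (fun j => _) = geometric (l%:R / (b%:R - 1)) b%:R^-1).
  by apply: cvg_geometric; rewrite ger0_norm ?invr_ge0 // invf_lt1 // ltr1n.
by apply/funext => j /=; rewrite invfM mulrA exprVn.
Qed.

(** From [j = n] on, [tail x l j] is non-decreasing, each actual digit replacing a digit [l] that is
    no larger, and it tends to [X]. *)
Lemma codes_ge x X n (l : nat) : codes x X ->
  (forall i, (n <= i)%N -> (l <= x i)%N) ->
  (wval (mkseq x n))%:R / b%:R ^+ n + l%:R / ((b%:R - 1) * b%:R ^+ n) <= X.
Proof.
move=> /(cvg_tail l) xX lx; rewrite -digits_sum_wval; apply: (cvgr_to_ge xX).
exists n => // j /= /subnKC <-; elim: (j - n)%N => [|k IH]; first by rewrite addn0.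
apply: le_trans IH _; rewrite addnS tailS lerDl divr_ge0 ?exprn_ge0 //.
by rewrite subr_ge0 ler_nat lx // leq_addr.
Qed.

Lemma codes_le x X n (l : nat) : codes x X ->
  (forall i, (n <= i)%N -> (x i <= l)%N) ->
  X <= (wval (mkseq x n))%:R / b%:R ^+ n + l%:R / ((b%:R - 1) * b%:R ^+ n).
Proof.
move=> /(cvg_tail l) xX lx; rewrite -digits_sum_wval; apply: (cvgr_to_le xX).
exists n => // j /= /subnKC <-; elim: (j - n)%N => [|k IH]; first by rewrite addn0.
apply: le_trans IH; rewrite addnS tailS gerDl mulr_le0_ge0 ?invr_ge0 ?exprn_ge0 //.
by rewrite subr_le0 ler_nat lx // leq_addr.
Qed.

Lemma codes_exists x : exists X, codes x X.
Proof.
exists (limn (digits_sum x)); apply: nondecreasing_is_cvgn.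
  by apply/nondecreasing_seqP => n; rewrite /digits_sum seriesSr lerDl divr_ge0 ?exprn_ge0.
(* Completing with the constant digit [b - 1] gives values that dominate the partial sums and never
   increase from their initial value 1. *)
exists 1 => _ [n _ <-]; apply: (@le_trans _ _ (tail x (b - 1) n)).
  by rewrite lerDl divr_ge0 ?mulr_ge0 ?exprn_ge0 // ltW.
elim: n => [|n IH].
  by rewrite /tail digits_sum_wval /= mul0r add0r mulr1 natrB ?divff ?gt_eqF //; lia.
apply: le_trans IH; rewrite tailS gerDl mulr_le0_ge0 ?invr_ge0 ?exprn_ge0 //.
by rewrite subr_le0 ler_nat; have := ltn_ord (x n); lia.
Qed.

(** The upper bound is [codes_le] for the digit [b - 1 - m]: the constant digit [b - 1] would lead
    exactly to the next grid point. *)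
Lemma codes_interval (m : nat) x X n : codes x X ->
  (forall i, (m <= x i)%N && (x i + m <= b - 1)%N) ->
  let v : R := (wval (mkseq x n))%:R in let r : R := m%:R / ((b%:R - 1) * b%:R ^+ n) in
  v / b%:R ^+ n + r <= X <= (v + 1) / b%:R ^+ n - r.
Proof.
move=> xX xm /=; apply/andP; split; first by apply: codes_ge => // i _; case/andP: (xm i).
have := @codes_le x X n (b - 1 - m)%N xX _.
have mb : (m <= b - 1)%N by have := xm 0%N; lia.
have -> : ((b - 1 - m)%N%:R = b%:R - 1 - m%:R :> R) by rewrite !natrB //; lia.
move=> le; apply: le_trans (le _) _; first by move=> i _; have := xm i; lia.
rewrite le_eqVlt; apply/orP; left; apply/eqP; field.
by rewrite !gt_eqF.
Qed.

Lemma codes_itv x X : codes x X -> 0 <= X <= 1.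
Proof.
move=> xX; have := @codes_interval 0 x X 0 xX; rewrite /= !mul0r addr0 subr0 add0r expr0 divr1.
by apply => i; have := ltn_ord (x i); lia.
Qed.

End Coding.

(** * Countable subadditivity and the Hausdorff-Cantelli lemma *)

Section HausdorffSeries.
Variables (R : realType) (f : R -> R).
Hypothesis f_gt0 : forall r : R, 0 < r -> 0 < f r.
Hypothesis f_le : forall r s : R, 0 < r -> r <= s -> f r <= f s.

Lemma hausdorff_delta_bigcup_le d (E : nat -> set R) (c : nat -> \bar R) :
  (forall i, 0 <= c i)%E -> (forall i, hausdorff_delta f d (E i) <= c i)%E ->
  (hausdorff_delta f d (\bigcup_i E i) <= \sum_(i <oo) c i)%E.
Proof.
move=> c0 Ec; have [[i ci]|cfin] := pselect (exists i, c i = +oo%E).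
  rewrite (eseries_pinfty _ _ ci) ?leey // => n _.
  by rewrite -ltNye (lt_le_trans _ (c0 _)).
apply/lee_addgt0Pr => e e0; apply: le_trans (epsilon_trick _ c0 (ltW e0)).
apply: hausdorff_delta_bigcup => // i; apply: le_lt_trans (Ec i) _.
rewrite lteDl ?lte_fin ?divr_gt0 ?ltr0n ?expn_gt0 //.
by rewrite ge0_fin_numE // ltey; apply/eqP => ci; apply: cfin; exists i.
Qed.

(** [E] lies in the union of the [F j] with [j >= i], whose cost is a tail of a convergent series.
    The bound on [F i] is asked from [n] on, because at coarse levels the pieces may be larger than
    [d]. *)
Lemma hausdorff_borel_cantelli d (E : set R) (F : nat -> set R) (c : nat -> R) (n : nat) :
  (forall i, 0 <= c i) -> (forall X, E X -> forall i, exists2 j, (i <= j)%N & F j X) ->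
  (forall i, (n <= i)%N -> hausdorff_delta f d (F i) <= (c i)%:E)%E ->
  (\sum_(i <oo) (c i)%:E < +oo)%E -> hausdorff_delta f d E = 0%E.
Proof.
move=> c0 EF Fc coo; apply/eqP; rewrite eq_le hausdorff_delta_ge0 // andbT.
have c0' i : (0 <= (c i)%:E)%E by rewrite lee_fin.
have tl := nneseries_tail_cvg coo (fun i _ => c0' i).
rewrite -(cvg_lim _ tl) //; apply: lime_ge; first by apply/cvg_ex; exists 0%E.
exists n => // i /= ni.
rewrite [leRHS]eseries_cond.
rewrite [leRHS]eseries_mkcond.
pose G j := if (i <= j)%N then F j else set0.
apply: (@le_trans _ _ (hausdorff_delta f d (\bigcup_j G j))).
  apply: hausdorff_delta_subset => X /EF /(_ i) [j ij FX].
  by exists j => //; rewrite /G ij.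
apply: hausdorff_delta_bigcup_le => [j|j]; first by case: ifP.
rewrite /G; case: ifP => ij; last first.
  apply: le_trans (hausdorff_delta_seq _ (s := [::]) _ _) _ => //.
  by rewrite big_nil.
by apply: Fc; exact: leq_trans ij.
Qed.

Lemma hausdorff_delta_seq_const d (E : set R) (s : seq (set R)) (c : R) :
  (forall x, E x -> exists2 U, U \in s & U x) ->
  (forall U, U \in s -> (diam U <= d%:E)%E) ->
  (forall U, U \in s -> (hcost f U <= c%:E)%E) ->
  (hausdorff_delta f d E <= ((size s)%:R * c)%:E)%E.
Proof.
move=> Es sd sc; apply: le_trans (hausdorff_delta_seq f_gt0 Es sd) _.
apply: (@le_trans _ _ (\sum_(U <- s) c%:E)%E).
  by rewrite big_seq [leRHS]big_seq; apply: lee_sum => U; exact: sc.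
by rewrite sumEFin big_const_seq count_predT iter_addr_0 mulr_natl.
Qed.

End HausdorffSeries.

(** * Neighbourhoods of b-adic grid points in the Cantor set *)

Section Grid.
Variables (R : realType) (b : nat) (D : {set 'I_b}) (m : nat) (f : R -> R).
Hypothesis b2 : (2 <= b)%N.
Hypothesis Dm : forall d : 'I_b, d \in D -> (m <= d)%N && (d + m <= b - 1)%N.
Hypothesis f_gt0 : forall r : R, 0 < r -> 0 < f r.
Hypothesis f_le : forall r s : R, 0 < r -> r <= s -> f r <= f s.
Let bn n : 0 < b%:R ^+ n :> R. Proof. by rewrite exprn_gt0 // ltr0n; lia. Qed.
Let thr N : R := m%:R / ((b%:R - 1) * b%:R ^+ N).

Let thr_ge0 N : 0 <= thr N.
Proof. by rewrite divr_ge0 ?mulr_ge0 ?exprn_ge0 // subr_ge0 ler1n; lia. Qed.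

Definition digit_code (x : nat -> 'I_b) (X : R) := codes x X /\ forall j, x j \in D.

Lemma digit_code_interval x X N : digit_code x X ->
  (wval (mkseq x N))%:R / b%:R ^+ N + thr N <= X <=
  ((wval (mkseq x N))%:R + 1) / b%:R ^+ N - thr N.
Proof. by case=> xX xD; apply: codes_interval => // i; exact: Dm. Qed.

(* [e] tells whether the grid point is the left or the right end of the interval. *)
Let piece N s (w : seq 'I_b) (e : nat) : set R := [set X | exists x,
  [/\ digit_code x X, mkseq x N = w & `|X - (wval w + e)%:R / b%:R ^+ N| < s]].

Definition near_grid N (s : R) : set R := [set X | (exists x, digit_code x X) /\
  exists p : nat, `|X - p%:R / b%:R ^+ N| < s].

(** A grid point is at least as far from [X] as the end point, on its side, of the level-[N]
    interval containing [X], so it can be replaced by that end point. *)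
Let near_grid_piece N s X : near_grid N s X ->
  exists w e, [/\ w \in words (enum D) N, e \in [:: 0%N; 1%N] & piece N s w e X].
Proof.
move=> [[x xX] [p pX]]; exists (mkseq x N).
have wW : mkseq x N \in words (enum D) N.
  by apply: mkseq_words => i; rewrite mem_enum; case: xX.
have /andP[lX Xr] := digit_code_interval N xX; have t0 := thr_ge0 N.
set v := wval (mkseq x N) in lX Xr *.
have mono (i j : nat) : (i <= j)%N -> i%:R / b%:R ^+ N <= j%:R / b%:R ^+ N :> R.
  by move=> ij; rewrite ler_pM2r ?invr_gt0 // ler_nat.
have [pv|vp] := leqP p v; [exists 0%N|exists 1%N]; split => //; exists x; split => //.
  apply: le_lt_trans pX; rewrite addn0; have pv' := mono _ _ pv.
  by rewrite !ger0_norm; move: pv' lX t0; rewrite -/v; lra.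
apply: le_lt_trans pX; have pv' := mono _ _ vp; rewrite addn1 in pv' *.
rewrite -natr1 in pv' *.
rewrite -/v !ler0_norm; move: pv' Xr t0; lra.
Qed.

Lemma near_grid_empty N s : s <= thr N -> near_grid N s = set0.
Proof.
move=> st; apply/seteqP; split=> // X /near_grid_piece[w [e [_ e01 [x [xX <-]]]]].
have /andP[lX Xr] := digit_code_interval N xX.
rewrite ltNge => /negP[]; apply: le_trans st _.
move: e01; rewrite !inE => /orP[/eqP->|/eqP->]; rewrite ?addn0 ?addn1 -?natr1.
  by apply: le_trans (ler_norm _); rewrite lerBrDl.
by rewrite distrC; apply: le_trans (ler_norm _); rewrite lerBrDr addrC -lerBrDr.
Qed.

(** Within a piece the distances to the end point lie between [thr N] and [s], all on one side, so
    its diameter is at most [s - thr N]. Each word gives two pieces, one per end point. *)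
Lemma near_grid_cover N s d : thr N < s -> (b%:R ^+ N)^-1 <= d ->
  (hausdorff_delta f d (near_grid N s)
     <= (2 * (#|D|%:R ^+ N) * f (s - thr N))%:E)%E.
Proof.
move=> ts Nd.
pose S := [seq piece N s w e | w <- words (enum D) N, e <- [:: 0%N; 1%N]].
have pieceP U : U \in S -> forall X Y, U X -> U Y ->
    `|X - Y| <= s - thr N /\ `|X - Y| <= (b%:R ^+ N)^-1.
  move=> /allpairsP[[w e] /= [_ e01 ->]] X Y [x [xX xw sX]] [y [yY yw sY]].
  have /andP[] := digit_code_interval N xX; have /andP[] := digit_code_interval N yY.
  rewrite xw yw mulrDl mul1r; have := thr_ge0 N; move: sX sY.
  move: e01; rewrite !inE => /orP[/eqP->|/eqP->]; rewrite ?addn0 ?addn1 -?natr1 ?mulrDl ?mul1r.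
    set v := _ / _; set i := _^-1; set t := thr N.
    rewrite !ltr_norml => /andP[? ?] /andP[? ?] *.
    by rewrite !ler_norml; split; apply/andP; split; lra.
  set v := _ / _; set i := _^-1; set t := thr N.
  rewrite !ltr_norml => /andP[? ?] /andP[? ?] *.
  by rewrite !ler_norml; split; apply/andP; split; lra.
have -> : 2 * (#|D|%:R ^+ N) * f (s - thr N) = (size S)%:R * f (s - thr N).
  by rewrite size_allpairs size_words -cardE natrM natrX [2 * _]mulrC.
apply: hausdorff_delta_seq_const => //.
- move=> X /near_grid_piece[w [e [wW e01 Xp]]]; exists (piece N s w e) => //.
  by apply/allpairsP; exists (w, e).
- move=> U /pieceP UP; apply: diam_le => X Y UX UY.
  by apply: le_trans Nd; case: (UP X Y).
- move=> U /pieceP UP; apply: hcost_le => // [|X Y UX UY]; first by rewrite subr_gt0.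
  by case: (UP X Y).
Qed.

End Grid.

(** * Divisibility between powers of t and powers of b *)

Section Alpha.
Variable R : realType.

Lemma foldr_min_le (x0 x : R) s : x \in s -> foldr Num.min x0 s <= x.
Proof.
elim: s => //= y s IH; rewrite in_cons ge_min => /predU1P[->|/IH->]; first by rewrite lexx.
by rewrite orbT.
Qed.

Lemma foldr_min_gt (x0 y : R) s : y < x0 -> {in s, forall x, y < x} ->
  y < foldr Num.min x0 s.
Proof.
move=> yx0; elim: s => //= x s IH h; rewrite lt_min h ?mem_head //=.
by apply: IH => z zs; apply: h; rewrite in_cons zs orbT.
Qed.

Lemma foldr_max_ge (x0 x : R) s : x \in s -> x <= foldr Num.max x0 s.
Proof.
elim: s => //= y s IH; rewrite in_cons le_max => /predU1P[->|/IH->]; first by rewrite lexx.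
by rewrite orbT.
Qed.

Lemma dvdn_of_logn n k : (0 < n)%N -> (0 < k)%N ->
  (forall p, prime p -> (logn p n <= logn p k)%N) -> (n %| k)%N.
Proof.
move=> n0 k0 le; apply/dvdn_partP => // p /[!mem_primes]/andP[pp _].
by rewrite p_part pfactor_dvdn // le.
Qed.

Variables b t : nat.
Hypotheses (b2 : (2 <= b)%N) (t2 : (2 <= t)%N).
Hypothesis bt : forall p : nat, prime p -> (p %| t)%N = (p %| b)%N.

Let ratio p : R := (logn p t)%:R / (logn p b)%:R.

Let ratio_gt0 p : p \in primes b -> 0 < ratio p.
Proof.
rewrite mem_primes => /and3P[pp b0 pb].
by rewrite divr_gt0 // ltr0n logn_gt0 mem_primes pp ?b0 ?pb ?bt //= ?pb; lia.
Qed.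

Let pdiv_b : pdiv b \in primes b.
Proof. by rewrite mem_primes pdiv_prime // pdiv_dvd; lia. Qed.

Lemma alpha1_gt0 : 0 < alpha1 R b t.
Proof.
have h : {in alpha_seq R b t, forall x, 0 < x} by move=> _ /mapP[p pb ->]; exact: ratio_gt0.
(* The fold starts from the head of the list, which is a genuine ratio and not the default 0 because
   [b] has a prime divisor. *)
apply: foldr_min_gt => //; move: h; rewrite /alpha_seq.
case: (primes b) pdiv_b => //= p s _; apply; exact: mem_head.
Qed.

Lemma alpha1_le p : p \in primes b -> alpha1 R b t <= ratio p.
Proof. by move=> pb; apply: foldr_min_le; apply: map_f. Qed.

Lemma alpha2_ge p : p \in primes b -> ratio p <= alpha2 R b t.
Proof. by move=> pb; apply: foldr_max_ge; apply: map_f. Qed.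

Lemma alpha2_gt0 : 0 < alpha2 R b t.
Proof. exact: lt_le_trans (ratio_gt0 pdiv_b) (alpha2_ge pdiv_b). Qed.

Let logn_t0 p : prime p -> p \notin primes b -> logn p t = 0%N.
Proof.
move=> pp; rewrite mem_primes pp /= => pb; apply/eqP; rewrite -leqn0 leqNgt logn_gt0.
by rewrite mem_primes pp bt //=; move: pb; case: (p %| b)%N; rewrite ?andbF ?andbT //; lia.
Qed.

(** Prime by prime, [N * logn p b <= i * alpha1 * logn p b <= i * logn p t]. *)
Lemma dvdn_exp_floor i N : N%:R <= i%:R * alpha1 R b t -> (b ^ N %| t ^ i)%N.
Proof.
move=> Ni; apply: dvdn_of_logn => [||p pp]; rewrite ?expn_gt0 //; try lia.
rewrite !lognX; have [pb|pb] := boolP (p \in primes b); last first.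
  by have := pb; rewrite -logn_gt0 -eqn0Ngt => /eqP->; rewrite muln0.
have := pb; rewrite -logn_gt0 => lb.
rewrite -(ler_nat R) !natrM -ler_pdivlMr ?ltr0n //.
apply: le_trans Ni _; rewrite -mulrA ler_wpM2l //; exact: alpha1_le.
Qed.

Lemma dvdn_exp_ceil i N : i%:R * alpha2 R b t <= N%:R -> (t ^ i %| b ^ N)%N.
Proof.
move=> iN; apply: dvdn_of_logn => [||p pp]; rewrite ?expn_gt0 //; try lia.
rewrite !lognX; have [pb|pb] := boolP (p \in primes b); last first.
  by rewrite logn_t0 // muln0.
have := pb; rewrite -logn_gt0 => lb.
rewrite -(ler_nat R) !natrM -ler_pdivrMr ?ltr0n //.
apply: le_trans iN; rewrite -mulrA ler_wpM2l //; exact: alpha2_ge.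
Qed.

End Alpha.

(** * Floors, ceilings and powers with exponent gamma *)

Section FloorCeil.
Variable R : realType.
Implicit Types x : R.

Lemma floor_nat x : 0 <= x -> exists2 N : nat, Num.floor x = N & N%:R <= x < N%:R + 1.
Proof.
move=> x0; have := floor_itv x; have : (0 <= Num.floor x)%R by rewrite floor_ge0.
case: (Num.floor x) => // N _; rewrite intrD => h; by exists N.
Qed.

Lemma ceil_nat x : 0 <= x -> exists2 N : nat, Num.ceil x = N & x <= N%:R < x + 1.
Proof.
move=> x0; have : (0 <= Num.ceil x)%R by rewrite ceil_ge0; lra.
have := ceil_ge x; have := ceil_gt_int x (Num.ceil x - 1); rewrite ltrBlDr ltrDl ltr01.
case: (Num.ceil x) => // N /esym; rewrite intrB => lt le _.
by exists N => //; rewrite le /=; move: lt; lra.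
Qed.

(** This is [b ^ gamma = #D]: the weight of the [i]-th term of the series becomes [#D ^ (i alpha)],
    up to rounding the number of cylinders of level [i alpha]. *)
Lemma powR_gamma (b q : nat) x : (0 < q)%N -> (2 <= b)%N ->
  b%:R `^ (x * (ln (q%:R : R) / ln (b%:R : R))) = q%:R `^ x.
Proof.
move=> q0 b2; rewrite mulrC powRrM; congr (_ `^ _).
rewrite /powR pnatr_eq0 gtn_eqF ?mulfVK; first by rewrite lnK // posrE ltr0n.
  by rewrite gt_eqF // ln_gt0 // ltr1n.
by lia.
Qed.

End FloorCeil.

(** * The limsup set in terms of psi_A *)

Section LimsupSet.
Variables (R : realType) (t : nat) (a : nat -> nat) (psi : nat -> R).
Hypothesis t2 : (2 <= t)%N.
Hypothesis a_le : forall n k, (0 < n)%N -> (n <= k)%N -> (a n <= a k)%N.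
Hypothesis a_unbounded : forall M : nat, exists2 n, (0 < n)%N & (M < a n)%N.

Lemma psiA_nonempty i : i \in Iset a -> [set psi n | n in [set n | (0 < n)%N /\ a n = i]] !=set0.
Proof. by rewrite inE => -[n n0 an]; exists (psi n), n. Qed.

(** The supremum is over a bounded set: [a] is non-decreasing and unbounded, so only finitely many
    indices share the value [a n]. *)
Lemma psi_le_psiA n : (0 < n)%N -> psi n <= psiA a psi (a n).
Proof.
move=> n0; apply: ub_le_sup; last by exists n.
have [k k0 ak] := a_unbounded (a n).
exists (\sum_(j < k) `|psi j|) => _ [j [j0 aj] <-].
have jk : (j < k)%N by rewrite ltnNge; apply/negP => /(a_le k0); lia.
rewrite (bigD1 (Ordinal jk)) //=; apply: le_trans (ler_norm _) _.
by rewrite lerDl sumr_ge0.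
Qed.

Lemma W_set_often X : W_set t a psi X -> forall i, exists2 j, (i <= j)%N &
  j \in Iset a /\ exists p : nat, `|X - p%:R / t%:R ^+ j| < psiA a psi j.
Proof.
move=> [X01 inf] i; apply: contrapT => none; apply: inf.
have [k k0 ak] := a_unbounded i.
(* If no solution had [a n >= i], all of them would satisfy [n < k], and then
   [p <= t ^ a n * (X + |psi n|) <= B]: finitely many pairs. *)
pose B : R := \sum_(j < k) t%:R ^+ a j * (X + `|psi j|).
apply: (@sub_finite_set _ _ (`I_(Num.truncn B).+1 `*` `I_k)); last exact: finite_setX.
move=> [p n] /= [n0 lt].
have ni : (a n < i)%N.
  rewrite ltnNge; apply/negP => ian; apply: none; exists (a n) => //; split.
    by rewrite inE; exists n.
  by exists p; apply: lt_le_trans lt _; exact: psi_le_psiA.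
have nk : (n < k)%N by rewrite ltnNge; apply/negP => /(a_le k0); lia.
split => //; rewrite ltnS; have X0 : 0 <= X by case/andP: X01.
have tn j : 0 < t%:R ^+ j :> R by rewrite exprn_gt0 // ltr0n; lia.
have pB : p%:R <= B.
  rewrite /B (bigD1 (Ordinal nk)) //= -[leLHS]addr0 lerD //; last first.
    by apply: sumr_ge0 => j _; rewrite mulr_ge0 ?addr_ge0 // ltW.
  rewrite mulrC -ler_pdivrMr //; move: lt; rewrite ltr_distlC => /andP[_ lt].
  by apply/ltW/(lt_le_trans lt); rewrite lerD2l ler_norm.
have /truncn_itv/andP[_] : 0 <= B by apply: le_trans pB.
by move=> /(le_lt_trans pB); rewrite ltr_nat ltnS.
Qed.

End LimsupSet.

(** * Points with infinitely many runs *)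

Section Cylinders.
Variables (R : realType) (b : nat).
Hypothesis b2 : (2 <= b)%N.
Let bn n : 0 < b%:R ^+ n :> R. Proof. by rewrite exprn_gt0 // ltr0n; lia. Qed.

Lemma exp_inv_lt (e : R) : 0 < e -> exists n, (b%:R ^+ n)^-1 < e.
Proof.
move=> e0; have /archi_boundP : 0 <= e^-1 by rewrite invr_ge0 ltW.
set n := Num.bound _ => en; exists n; rewrite invf_plt ?posrE //.
apply: lt_trans en _; rewrite -natrX ltr_nat; exact: ltn_expl.
Qed.

Lemma exp_inv_le n l : (n <= l)%N -> (b%:R ^+ l)^-1 <= (b%:R ^+ n)^-1 :> R.
Proof.
by move=> nl; rewrite lef_pV2 ?posrE // ler_weXn2l // ler1n; lia.
Qed.

Variable D : {set 'I_b}.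

Definition cylinder (w : seq 'I_b) : set R :=
  [set X | exists x, digit_code D x X /\ mkseq x (size w) = w].

Lemma cylinderP w X : cylinder w X ->
  (wval w)%:R / b%:R ^+ size w <= X <= ((wval w)%:R + 1) / b%:R ^+ size w.
Proof.
move=> [x [xX xw]]; have := @digit_code_interval R b D 0 b2 _ _ _ (size w) xX.
rewrite xw mul0r addr0 subr0; apply => d _; have := ltn_ord d; lia.
Qed.

Lemma cylinder_diam w X Y : cylinder w X -> cylinder w Y ->
  `|X - Y| <= (b%:R ^+ size w)^-1.
Proof.
move=> /cylinderP + /cylinderP; rewrite mulrDl mul1r ler_norml.
by set v := _ / _; set i := _^-1; lra.
Qed.

End Cylinders.

Section Runs.
Variables (R : realType) (b : nat) (D : {set 'I_b}) (f : R -> R).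
Hypothesis b2 : (2 <= b)%N.
Hypothesis f_gt0 : forall r : R, 0 < r -> 0 < f r.
Hypothesis f_le : forall r s : R, 0 < r -> r <= s -> f r <= f s.
Variables (d0 d1 : 'I_b).
Hypotheses (d0D : d0 \in D) (d1D : d1 \in D) (d01 : d1 != d0).
Local Notation q := #|D|.
Local Notation ds := (enum D).
Local Notation phi n := (f (b%:R ^+ n)^-1).

Variables (a k : nat -> nat) (act : pred nat).
Hypothesis a_lt : {homo a : i j / (i < j)%N}.

(** The run occupies the positions from [a j + 1] to [a j + k j]; position [a j] itself is where the
    pattern puts [d1]. *)
Definition run j (x : nat -> 'I_b) := forall t, (t < k j)%N -> x (a j + t.+1)%N = d0.
Definition runs_often x := forall i, exists j, [/\ act j, (i <= j)%N & run j x].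

Let bn n : 0 < b%:R ^+ n :> R. Proof. by rewrite exprn_gt0 // ltr0n; lia. Qed.
Let bi n : 0 < (b%:R ^+ n)^-1 :> R. Proof. by rewrite invr_gt0. Qed.
Let q0 : (0 < q)%N. Proof. by apply/card_gt0P; exists d0. Qed.
Let qn n : 0 < q%:R ^+ n :> R. Proof. by rewrite exprn_gt0 // ltr0n. Qed.
Let d0ds : d0 \in ds. Proof. by rewrite mem_enum. Qed.
Let d1ds : d1 \in ds. Proof. by rewrite mem_enum. Qed.
Let uds : uniq ds. Proof. exact: enum_uniq. Qed.

Section FullMeasure.
Variable C : R.
Hypothesis f_bound : forall n, phi n <= C / q%:R ^+ n.
Hypothesis div : forall i (B : R), exists n, B <= \sum_(i <= j < n | act j) (q%:R ^+ (k j).+1)^-1.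

Let avoid i : set R := [set X | exists x, digit_code D x X /\
  forall j, (i <= j)%N -> act j -> ~ run j x].

(** Points without the runs also avoid the patterns starting with [d1]. By [avoid_bound] at most
    [q ^ L / s] words of length [L] do so, with [s] a partial sum of the divergent series, and each
    costs at most [C / q ^ L]; choosing [s >= C / e] leaves a cost at most [e]. *)
Let hausdorff_delta_avoid d i : 0 < d -> hausdorff_delta f d (avoid i) = 0%E.
Proof.
move=> d0'; apply/eqP; rewrite eq_le hausdorff_delta_ge0 // andbT.
apply/lee_addgt0Pr => e e0; rewrite add0e.
have C0 : 0 < C.
  by have := lt_le_trans (f_gt0 (bi 0)) (f_bound 0); rewrite divr1.
have [n nP] := div i (C / e).
pose r := [seq j <- index_iota i n | act j].
have [l lP] := exp_inv_lt b2 d0'.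
(* Long enough to contain the patterns and to make the cylinders smaller than [d]. *)
pose L := maxn l (\max_(j <- r) (a j + (k j).+1)%N).
have fit : {in r, forall j, (a j + (k j).+1 <= L)%N}.
  move=> j jr; rewrite /L leq_max; apply/orP; right.
  by rewrite (big_rem j) //= leq_maxl.
pose ok w := all (fun j => ~~ occurs (pat d0 d1 (k j)) (a j) w) r.
pose S : seq (set R) := [seq cylinder D w | w <- words ds L & ok w].
have := avoid_bound uds R d0ds d1ds d01 a_lt (filter_uniq _ (iota_uniq _ _)) fit.
rewrite -cardE [X in _ * X]big_filter => Zle.
have SE U : U \in S -> exists2 w, size w = L & U = cylinder D w.
  move=> /mapP[w]; rewrite mem_filter mem_words => /and3P[_ /eqP sw _] ->.
  by exists w.
have Ssize : (size S)%:R = \sum_(w <- words ds L) (ok w)%:R :> R.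
  rewrite size_map size_filter -sum1_count natr_sum big_mkcond.
  by apply: eq_bigr => w _; case: (ok w).
apply: le_trans (hausdorff_delta_seq_const f_gt0 (s := S) (c := C / q%:R ^+ L) _ _ _) _.
- move=> X [x [xX xr]]; exists (cylinder D (mkseq x L)); last first.
    by exists x; rewrite size_mkseq.
  apply: map_f; rewrite mem_filter mkseq_words ?andbT; last first.
    by move=> j; rewrite mem_enum; case: xX.
  apply/allP => j jr; apply/negP => o.
  move: (jr); rewrite mem_filter mem_index_iota => /and3P[actj ij _].
  apply: (xr j ij actj) => t tk; have := fit j jr => jL.
  have := occurs_nth o tk; rewrite nth_pat // nth_mkseq //.
  by apply: leq_trans jL; rewrite ltn_add2l.
- move=> U /SE[w wL ->]; apply: diam_le => X Y wX wY.
  apply: le_trans (cylinder_diam b2 wX wY) _; rewrite wL; apply: le_trans (ltW lP).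
  by apply: exp_inv_le => //; exact: leq_maxl.
- move=> U /SE[w wL ->]; apply: le_trans (hcost_le f_gt0 f_le (bi L) _) _.
    by move=> X Y wX wY; rewrite -wL; exact: (cylinder_diam b2 wX wY).
  by rewrite lee_fin.
rewrite lee_fin Ssize mulrA ler_pdivrMr //; set Z := \sum_(w <- _) _ in Zle *.
have Z0 : 0 <= Z by apply: sumr_ge0.
move: nP; rewrite ler_pdivrMr // => nP.
apply: (@le_trans _ _ (Z * ((\sum_(i <= j < n | act j) (q%:R ^+ (k j).+1)^-1) * e))).
  by rewrite ler_wpM2l.
by rewrite mulrA mulrC ler_pM2l.
Qed.

(** The Cantor set is covered by [E] and the sets [avoid i], which have zero [hausdorff_delta] at
    every scale. *)
Lemma hausdorff_measure_full (E : set R) :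
  (forall x X, digit_code D x X -> runs_often x -> E X) -> E `<=` @cantor_set R b D ->
  hausdorff_measure f E = hausdorff_measure f (@cantor_set R b D).
Proof.
move=> runE EC; apply/eqP; rewrite eq_le; apply/andP; split.
  apply: ge_ereal_sup => _ [d d0' <-].
  apply: (@le_trans _ _ (hausdorff_delta f d (@cantor_set R b D))).
    exact: hausdorff_delta_subset.
  by apply: ereal_sup_ubound; exists d.
apply: ge_ereal_sup => _ [d d0' <-]; apply: (@le_trans _ _ (hausdorff_delta f d E)).
  2: by apply: ereal_sup_ubound; exists d.
pose F i := if i is i'.+1 then avoid i' else E.
pose c i : \bar R := if i is i'.+1 then 0%E else hausdorff_delta f d E.
apply: (@le_trans _ _ (hausdorff_delta f d (\bigcup_i F i))).
  apply: hausdorff_delta_subset => X [_ [x [xD xX]]].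
  have [|nruns] := pselect (runs_often x); first by move=> /runE EX; exists 0%N => //; exact: EX.
  have [i iP] : exists i, forall j, (i <= j)%N -> act j -> ~ run j x.
    apply: contrapT => none; apply: nruns => i; apply: contrapT => nj; apply: none.
    by exists i => j ij actj rj; apply: nj; exists j.
  by exists i.+1 => //; exists x.
apply: le_trans (hausdorff_delta_bigcup_le f_gt0 (c := c) _ _) _.
- by case=> //=; exact: hausdorff_delta_ge0.
- by case=> [|i] //=; rewrite hausdorff_delta_avoid.
rewrite (nneseries_split 0 1) => [|[|i] _] //=; last exact: hausdorff_delta_ge0.
by rewrite big_nat1 eseries0 ?adde0 // => -[].
Qed.

End FullMeasure.

Section Infinite.
Hypothesis f_cvg0 : forall e : R, 0 < e -> exists n, phi n < e.
Hypothesis g_le : forall m n, (m <= n)%N -> phi m * q%:R ^+ m <= phi n * q%:R ^+ n.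
Hypothesis g_unbounded : forall B : R, exists n, B < phi n * q%:R ^+ n.
Hypothesis div : forall i (B : R), exists n,
  B <= \sum_(i <= j < n | act j) q%:R ^+ a j * phi (a j + (k j).+1).

Let phi_le m n : (m <= n)%N -> phi n <= phi m.
Proof. by move=> mn; apply: f_le => //; exact: exp_inv_le. Qed.

Let a_ge j : (j <= a j)%N.
Proof. by elim: j => // j /leq_ltn_trans; apply; exact: a_lt. Qed.

Let phiS n : phi n <= q%:R * phi n.+1.
Proof.
have := g_le (leqnSn n); rewrite [q%:R ^+ n.+1]exprSr mulrA mulrAC ler_pM2r // => h.
by rewrite mulrC.
Qed.

(* [hcost] is [0] on sets of diameter [0]: these are covered by cylinders of arbitrarily
   small cost [e]. *)
Let level_of (U : set R) n0 (e : R) : 0 < e -> (diam U <= ((b%:R ^+ n0)^-1)%:E)%E ->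
  exists l, [/\ (n0 <= l)%N, forall X Y, U X -> U Y -> `|X - Y| <= (b%:R ^+ l)^-1 &
    ((phi l)%:E <= q%:R%:E * hcost f U + e%:E)%E].
Proof.
move=> e0 Ud.
have qh : (0 <= q%:R%:E * hcost f U)%E by rewrite mule_ge0 // hcost_ge0.
have UdXY X Y : U X -> U Y -> (`|X - Y|%:E <= diam U)%E by exact: le_diam.
have small : (forall X Y, U X -> U Y -> `|X - Y| <= 0) -> exists l, [/\ (n0 <= l)%N,
    forall X Y, U X -> U Y -> `|X - Y| <= (b%:R ^+ l)^-1 &
    ((phi l)%:E <= q%:R%:E * hcost f U + e%:E)%E].
  move=> U0; have [n ne] := f_cvg0 e0; exists (maxn n0 n); split.
  - exact: leq_maxl.
  - by move=> X Y UX UY; apply: le_trans (U0 X Y UX UY) _; exact: ltW.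
  - rewrite -[leLHS]add0e leeD // lee_fin; apply: le_trans (ltW ne).
    by apply: phi_le; exact: leq_maxr.
case dU : (diam U) => [r| |] in UdXY Ud; last 2 first.
- by move: Ud; rewrite leye_eq.
- by apply: small => X Y UX UY; have := UdXY X Y UX UY; rewrite leeNy_eq.
have [r0|r0] := ltrP 0 r; last first.
  by apply: small => X Y UX UY; apply: le_trans r0; rewrite -lee_fin UdXY.
(* The first [n] with [b ^ -n < r] is some [l.+1], and [b ^ -(l+1) < r <= b ^ -l] gives
   [phi l <= q * phi l.+1 <= q * f r]. *)
case: (ex_minnP (exp_inv_lt b2 r0)) => n nr nmin.
rewrite lee_fin in Ud.
have n0n : (n0 < n)%N.
  rewrite ltnNge; apply/negP => /(exp_inv_le R b2) le; have := lt_le_trans nr (le_trans Ud le).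
  by rewrite ltxx.
case: n nr nmin n0n => // l lr lmin; rewrite ltnS => n0l; exists l; split => //.
  move=> X Y UX UY; rewrite -lee_fin; apply: le_trans (UdXY X Y UX UY) _.
  rewrite lee_fin leNgt; apply/negP => /lmin; by rewrite ltnn.
rewrite /hcost dU r0 -EFinM -EFinD lee_fin; apply: le_trans (phiS l) _.
rewrite -[leLHS]addr0 lerD ?(ltW e0) // ler_pM2l ?ltr0n //; apply: f_le => //; exact: ltW.
Qed.

Let meeting (U : set R) l : seq (seq 'I_b) :=
  [seq w <- words ds l | `[< exists X, U X /\ cylinder D w X >]].

(** Any two such cylinders have integer values differing by at most 2, so all the values lie in a
    window of five consecutive integers. *)
Let size_meeting (U : set R) l :
  (forall X Y, U X -> U Y -> `|X - Y| <= (b%:R ^+ l)^-1) -> (size (meeting U l) <= 5)%N.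
Proof.
move=> Ul; have meetP w : w \in meeting U l -> size w = l /\ exists X, U X /\ cylinder D w X.
  by rewrite mem_filter mem_words => /and3P[/asboolP ? /eqP].
have close w w' : w \in meeting U l -> w' \in meeting U l -> (wval w <= wval w' + 2)%N.
  move=> /meetP[wl [X [UX wX]]] /meetP[w'l [Y [UY w'Y]]].
  have := cylinderP b2 wX; have := cylinderP b2 w'Y; rewrite wl w'l.
  have := Ul X Y UX UY; rewrite ler_norml -(ler_nat R) natrD.
  set v := (wval w)%:R; set v' := (wval w')%:R; have := bi l; set i := _^-1.
  move=> i0 /andP[_ XY] /andP[_ Y1] /andP[X0 _].
  have : v * i <= (v' + 2) * i by lra.
  by rewrite ler_pM2r.
case E : (meeting U l) => [//|w0 s]; rewrite -E.
have w0m : w0 \in meeting U l by rewrite E mem_head.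
rewrite -(size_map (@wval b)) -(size_iota (wval w0 - 2) 5); apply: uniq_leq_size.
  rewrite map_inj_in_uniq ?filter_uniq ?words_uniq // => w w' /meetP[wl _] /meetP[w'l _].
  by have := @wval_inj b b2 l w w'; rewrite !inE wl w'l eqxx => /(_ isT isT) h /h.
move=> _ /mapP[w wm ->]; rewrite mem_iota.
by have := close _ _ wm w0m; have := close _ _ w0m wm; lia.
Qed.

(** Each set of a cover of cost below [K] is replaced by at most five cylinders, at total cost
    [5 * (q * K + 1)], the 1 absorbing errors [2 ^ -(i+1)]. The greedy construction then produces a
    point of [E] outside the cover. *)
Lemma hausdorff_measure_infinite (E : set R) :
  (forall x X, digit_code D x X -> runs_often x -> E X) ->
  hausdorff_measure f E = +oo%E.
Proof.
move=> runE; apply/eqyP => K K0.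
(* The constant [cst] of the greedy construction, which starts at a level [n0] where [c * g n0]
   exceeds the total cost. *)
pose c : R := (4 * (1 + ((size ds)%:R + 1) * 3))^-1.
have c0 : 0 < c by rewrite invr_gt0 mulr_gt0 // ltr_wpDr // mulr_ge0 // addr_ge0.
have [n0 n0P] := g_unbounded (5 * (q%:R * K + 1) / c).
apply: (@le_trans _ _ (hausdorff_delta f (b%:R ^+ n0)^-1 E)); last first.
  by apply: ereal_sup_ubound; exists (b%:R ^+ n0)^-1 => //; exact: bi.
rewrite leNgt; apply/negP => /ereal_inf_lt[_ [U [EU Ud] <-] UK].
have e0 i : 0 < 1 / (2 ^ i.+1)%:R :> R by rewrite divr_gt0 // ltr0n expn_gt0.
have [l lP] := choice (fun i => level_of (e0 i) (Ud i)).
pose V i := meeting (U i) (l i).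
have VP i w : w \in V i -> size w = l i.
  by rewrite mem_filter mem_words => /and3P[_ /eqP].
have [] := @greedy_start _ ds R uds d0 d1 d0ds d1ds d01 (fun n => phi n)
  (fun n => f_gt0 (bi n)) phi_le _ f_cvg0 _ a k act a_lt _ V a_ge n0 (5 * (q%:R * K + 1)).
- by rewrite -cardE.
- by rewrite -cardE.
- by rewrite -cardE.
- by rewrite -/c [ltRHS]mulrC -ltr_pdivrMr // -cardE.
- by move=> j v /VP ->; have [] := lP j.
- move=> N; rewrite big_flatten big_map -lee_fin.
  apply: (@le_trans _ _ (\sum_(i <- iota 0 N)
      (5%:E * (q%:R%:E * hcost f (U i) + (1 / (2 ^ i.+1)%:R)%:E)))%E).
    rewrite -sumEFin; apply: lee_sum => i _.
    have [_ lU lphi] := lP i.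
    apply: (@le_trans _ _ (5%:E * (phi (l i))%:E)%E); last by rewrite lee_pmul2l.
    rewrite -EFinM lee_fin (eq_big_seq (fun=> phi (l i))); last by move=> w /VP ->.
    rewrite big_const_seq count_predT iter_addr_0 -[leLHS]mulr_natl ler_pM2r ?f_gt0 //.
    by rewrite (ler_nat _ _ 5) size_meeting.
  rewrite -ge0_sume_distrr; last first.
    by move=> i _; rewrite adde_ge0 ?mule_ge0 ?hcost_ge0 // lee_fin ltW.
  rewrite big_split /= -ge0_sume_distrr; last by move=> i _; exact: hcost_ge0.
  have iN : iota 0 N = index_iota 0 N by rewrite /index_iota subn0.
  have -> : (5 * (q%:R * K + 1))%:E = (5%:E * (q%:R%:E * K%:E + 1%:E))%E by [].
  rewrite iN lee_pmul2l // leeD //.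
    rewrite lee_pmul2l ?lte_fin ?ltr0n //; apply: le_trans (ltW UK).
    apply: nneseries_lim_ge => i *.
    exact: hcost_ge0.
  apply: le_trans (epsilon_trick0 xpredT ler01).
  by apply: nneseries_lim_ge => i *; rewrite lee_fin; exact/ltW/e0.
move=> x [xds xV xruns].
have [X xX] := codes_exists R b2 x.
have xX' : digit_code D x X by split => // j; rewrite -mem_enum.
have [|i _ UX] := EU X; first exact: runE xruns.
apply: (xV i (mkseq x (l i))); last by rewrite size_mkseq.
rewrite mem_filter mkseq_words // andbT; apply/asboolP; exists X; split => //.
by exists x; rewrite size_mkseq.
Qed.

End Infinite.
End Runs.

(** * Series with unbounded partial sums *)

Section UnboundedSums.
Variable R : realType.
Implicit Types u h : nat -> R.

Definition unbounded_sums u := forall B : R, exists n, B < \sum_(0 <= i < n) u i.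

(** If the sums of [h] were bounded, [h] would tend to 0, so [e <= h i] would fail eventually and
    [u i <= C * h i] would hold up to finitely many terms, which [G] absorbs. *)
Lemma unbounded_sums_transfer u h (C e : R) : 0 < e -> (forall i, 0 <= h i) ->
  (forall i, e <= h i \/ u i <= C * h i) -> 0 <= C ->
  unbounded_sums u -> unbounded_sums h.
Proof.
move=> e0 h0 euh C0 uoo B; apply: contrapT => hB.
have hle n : \sum_(0 <= i < n) h i <= B.
  by rewrite leNgt; apply/negP => lt; apply: hB; exists n.
have h_to0 : h @ \oo --> 0.
  apply: cvg_series_cvg_0; apply: nondecreasing_is_cvgn.
    by apply/nondecreasing_seqP => n; rewrite seriesSr lerDl.
  by exists B => _ [n _ <-]; exact: hle.
have [i0 _ i0P] : \forall i \near \oo, h i < e by exact: (cvgr_lt _ h_to0).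
pose G i := if (i < i0)%N then `|u i| else 0.
have G0 i : 0 <= G i by rewrite /G; case: ifP.
have uG i : u i <= C * h i + G i.
  rewrite /G; case: (ltnP i i0) => ii0.
    by rewrite -[leLHS]add0r lerD ?mulr_ge0 ?ler_norm.
  rewrite addr0; have /= := i0P i ii0; case: (euh i) => // eh.
  by rewrite ltNge eh.
have [n] := uoo (C * B + \sum_(0 <= i < i0) `|u i|); apply/negP; rewrite -leNgt.
apply: (@le_trans _ _ (\sum_(0 <= i < n) (C * h i + G i))); first exact: ler_sum.
rewrite big_split /= -mulr_sumr lerD // ?ler_wpM2l //.
apply: (@le_trans _ _ (\sum_(0 <= i < i0 + n) G i)).
  rewrite addnC [leRHS](big_cat_nat (leq0n n) (leq_addr _ _)) /= lerDl.
  exact: sumr_ge0.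
rewrite (big_cat_nat (leq0n i0) (leq_addr _ _)) /= [X in _ + X]big_nat_cond.
rewrite [X in _ + X]big1 ?addr0; last by move=> i /andP[/andP[ii0 _] _]; rewrite /G ltnNge ii0.
rewrite big_nat_cond [leRHS]big_nat_cond; apply: ler_sum => i /andP[/andP[_ ii0] _].
by rewrite /G ii0.
Qed.

(** Bounds for all the [M] residue classes would add up to a bound for the sums over whole blocks of
    length [M]. *)
Lemma unbounded_sums_residue u M : (0 < M)%N -> (forall i, 0 <= u i) ->
  unbounded_sums u -> exists r, unbounded_sums (fun j => u (M * j + r)%N).
Proof.
move=> M0 u0 uoo; apply: contrapT => none.
have /choice[B BP] : forall r, exists B, forall n, \sum_(0 <= j < n) u (M * j + r)%N <= B.
  move=> r; apply: contrapT => nB; apply: none; exists r => B.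
  apply: contrapT => nn; apply: nB; exists B => n.
  by rewrite leNgt; apply/negP => lt; apply: nn; exists n.
have blocks n : \sum_(0 <= i < M * n) u i =
    \sum_(0 <= r < M) \sum_(0 <= j < n) u (M * j + r)%N.
  elim: n => [|n IH].
    by rewrite muln0 big_geq // big1 // => r _; rewrite big_geq.
  rewrite mulnS addnC (big_cat_nat (leq0n (M * n)) (leq_addr _ _)) /= IH.
  have -> : \sum_(M * n <= i < M * n + M) u i = \sum_(0 <= r < M) u (M * n + r)%N.
    rewrite -{1}[(M * n)%N]add0n big_addn addKn.
    by apply: eq_bigr => r _; rewrite addnC.
  by rewrite -big_split /=; apply: eq_bigr => r _; rewrite big_nat_recr.
have [n] := uoo (\sum_(0 <= r < M) B r); apply/negP; rewrite -leNgt.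
apply: (@le_trans _ _ (\sum_(0 <= i < M * n) u i)).
  have nM : (n <= M * n)%N by rewrite leq_pmull.
  by rewrite [leRHS](big_cat_nat (leq0n n) nM) /= lerDl sumr_ge0.
by rewrite blocks; apply: ler_sum.
Qed.

(** Dropping the first [i + 1] terms changes the sums by a bounded amount; the shift [j.+1] is the
    one made by the later choice of [idx]. *)
Lemma unbounded_sums_tail u i B : unbounded_sums u ->
  exists n, B <= \sum_(i <= j < n) u j.+1.
Proof.
move=> uoo.
have [n nP] := uoo (`|B| + \sum_(0 <= j < i.+1) `|u j|).
have [ni|ni] := leqP n i.+1.
  move: nP; rewrite ltNge => /negP[]; rewrite -[leLHS]add0r lerD //.
  apply: (@le_trans _ _ (\sum_(0 <= j < n) `|u j|)).
    by apply: ler_sum => j _; exact: ler_norm.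
  by rewrite [leRHS](big_cat_nat (leq0n n) ni) /= lerDl sumr_ge0.
exists n.-1; move: nP; rewrite (big_cat_nat (leq0n i.+1) (ltnW ni)) /=.
case: n ni => // n ni; rewrite [n.+1.-1]/= [X in _ < _ + X]big_add1 /= => nP.
have le1 : \sum_(0 <= j < i.+1) u j <= \sum_(0 <= j < i.+1) `|u j|.
  by apply: ler_sum => j _; exact: ler_norm.
have := ler_norm B; lra.
Qed.

Lemma nneseries_unbounded (P : pred nat) (F : nat -> R) : (forall i, P i -> 0 <= F i) ->
  (\sum_(i <oo | P i) (F i)%:E = +oo)%E -> unbounded_sums (fun i => if P i then F i else 0).
Proof.
move=> F0 Foo B; apply: contrapT => none.
have : (\sum_(i <oo | P i) (F i)%:E <= B%:E)%E.
  rewrite eseries_mkcond; apply: lime_le.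
    by apply: is_cvg_nneseries => i _ _; case: ifP => // /F0; rewrite lee_fin.
  apply: nearW => n; rewrite (eq_bigr (fun i => (if P i then F i else 0)%:E)); last first.
    by move=> i _; case: ifP.
  by rewrite sumEFin lee_fin leNgt; apply/negP => lt; apply: none; exists n.
by rewrite Foo leye_eq.
Qed.

End UnboundedSums.

(** * Runs of an extreme digit and proximity to grid points *)

Section Target.
Variables (R : realType) (b : nat) (D : {set 'I_b}) (m : nat) (d0 : 'I_b).
Hypothesis b2 : (2 <= b)%N.
Hypothesis Dm : forall d : 'I_b, d \in D -> (m <= d)%N && (d + m <= b - 1)%N.
Hypothesis d0m : nat_of_ord d0 = m \/ (d0 + m = b - 1)%N.
Let bn n : 0 < b%:R ^+ n :> R. Proof. by rewrite exprn_gt0 // ltr0n; lia. Qed.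

(* Compare [X] with the point obtained by continuing the run of [d0] for ever,
   which lies at distance exactly [m / ((b - 1) b^N)] from the grid. *)
Lemma run_near_grid x (X : R) N k : digit_code D x X ->
  (forall t, (t < k)%N -> x (N + t)%N = d0) ->
  exists p : nat, `|X - p%:R / b%:R ^+ N|
    <= m%:R / ((b%:R - 1) * b%:R ^+ N) + (b%:R ^+ (N + k))^-1.
Proof.
move=> [xX xD] xrun; pose y i := if (i < N)%N then x i else d0.
have [Y yY] := codes_exists R b2 y.
have xy : mkseq x (N + k) = mkseq y (N + k).
  apply: (@eq_from_nth _ d0) => [|i]; rewrite !size_mkseq // => ik.
  rewrite !nth_mkseq // /y; case: ltnP => // Ni.
  by rewrite -(subnKC Ni) xrun // ltn_subLR.
have XY : `|X - Y| <= (b%:R ^+ (N + k))^-1.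
  have cyl z (Z : R) : codes z Z -> mkseq z (N + k) = mkseq x (N + k) ->
      cylinder [set: 'I_b]%SET (mkseq x (N + k)) Z.
    by move=> zZ zx; exists z; rewrite size_mkseq; split => //; split => // j; rewrite inE.
  by have := cylinder_diam b2 (cyl _ _ xX erefl) (cyl _ _ yY (esym xy)); rewrite size_mkseq.
have yN i : (N <= i)%N -> y i = d0 by rewrite /y ltnNge => ->.
pose v := wval (mkseq y N).
have YE : Y = v%:R / b%:R ^+ N + (nat_of_ord d0)%:R / ((b%:R - 1) * b%:R ^+ N).
  by apply/eqP; rewrite eq_le codes_le ?codes_ge // => i /yN ->.
have thr0 : 0 <= m%:R / ((b%:R - 1) * b%:R ^+ N) :> R.
  by rewrite divr_ge0 ?mulr_ge0 ?exprn_ge0 // subr_ge0 ler1n; lia.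
have near p : `|Y - p%:R / b%:R ^+ N| <= m%:R / ((b%:R - 1) * b%:R ^+ N) ->
    `|X - p%:R / b%:R ^+ N| <= m%:R / ((b%:R - 1) * b%:R ^+ N) + (b%:R ^+ (N + k))^-1.
  by move=> Yp; rewrite [leRHS]addrC (le_trans (ler_distD Y _ _)) // lerD.
(* The left end [v] is the near one when [d0 = m], the right end [v.+1] when [d0 = b - 1 - m]. *)
case: d0m => d0E; [exists v|exists v.+1]; apply: near; rewrite YE.
  by rewrite addrC addKr d0E ger0_norm.
have b1 : b%:R - 1 != 0 :> R by rewrite gt_eqF // subr_gt0 ltr1n.
have -> : (nat_of_ord d0)%:R = b%:R - 1 - m%:R :> R.
  by rewrite -(addrK m%:R (nat_of_ord d0)%:R) -natrD d0E natrB //; lia.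
rewrite (_ : _ - _ = - (m%:R / ((b%:R - 1) * b%:R ^+ N))) ?normrN ?ger0_norm //.
by rewrite -natr1; field; rewrite b1 gt_eqF.
Qed.

End Target.
(** Finitely many pairs would bound the values [a n]. At a level [j] beyond that bound the supremum
    exceeds the distance, so some [n] with [a n = j] yields a new pair. *)
Lemma W_set_intro (R : realType) (t : nat) (a : nat -> nat) (psi : nat -> R) X :
  0 <= X <= 1 ->
  (forall i, exists2 j, (i <= j)%N & j \in Iset a /\
     exists p : nat, `|X - p%:R / t%:R ^+ j| < psiA a psi j) ->
  W_set t a psi X.
Proof.
move=> X01 often; split => // /finite_seqP[s sE].
have [j lej [jI [p pX]]] := often (\max_(x <- s) a x.2).+1.
have [_ [n [n0 an] <-] Xn] := sup_gt (psiA_nonempty psi jI) pX.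
have : [set pn : nat * nat | (0 < pn.2)%N /\ `|X - pn.1%:R / t%:R ^+ a pn.2| < psi pn.2] (p, n).
  by rewrite /= an.
rewrite sE /= => ns; move: lej; rewrite -an (big_rem (p, n)) //=.
by rewrite ltnNge leq_maxl.
Qed.

(** * Extraction of strictly increasing run positions *)

Section Subsequence.
Variables (R : realType) (q : nat) (act : pred nat) (N k : nat -> nat) (M : nat).
Hypotheses (q0 : (0 < q)%N) (M0 : (0 < M)%N).
Hypothesis N_lt : forall i, (N i < N (M + i))%N.
Variable phi : nat -> R.
Hypothesis phi_gt0 : forall n, 0 < phi n.
Let h i : R := if act i then q%:R ^+ N i * phi (N i + k i) else 0.

(* [N] itself need not be injective, but it is increasing along residue classes mod [M];
   the positions [a j] are those of the digit just before each run. *)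
Lemma increasing_subsequence : unbounded_sums h -> exists idx a : nat -> nat,
  [/\ {homo a : i j / (i < j)%N}, forall j, N (idx j) = (a j).+1,
      forall j, (j <= idx j)%N &
      forall i B, exists n, B <= \sum_(i <= j < n | act (idx j))
        q%:R ^+ a j * phi (a j + (k (idx j)).+1)].
Proof.
move=> hoo.
have qn n : 0 < q%:R ^+ n :> R by rewrite exprn_gt0 // ltr0n.
have h0 i : 0 <= h i by rewrite /h; case: ifP => // _; rewrite mulr_ge0 ?ltW.
have [r roo] := unbounded_sums_residue M0 h0 hoo.
(* Taking [j.+1] makes [N (idx j)] positive, so that a digit precedes the run. *)
pose idx j := (M * j.+1 + r)%N.
have NS j : (N (M * j + r) < N (M * j.+1 + r))%N.
  by rewrite mulnS -addnA; exact: N_lt.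
have aE j : N (idx j) = (N (idx j)).-1.+1 by rewrite prednK // (leq_ltn_trans _ (NS j)).
exists idx, (fun j => (N (idx j)).-1); split=> //.
- apply: homo_ltn => [j i l|j]; first exact: ltn_trans.
  by rewrite -ltnS -!aE NS.
- move=> j; rewrite /idx; apply: leq_trans (leq_addr _ _).
  by rewrite (leq_trans (leqnSn j)) // leq_pmull.
(* Passing from [N (idx j)] to its predecessor loses a factor [q] in each term, hence [q * B]. *)
move=> i B; have [n nP] := unbounded_sums_tail i (q%:R * B) roo; exists n.
rewrite -(ler_pM2l (_ : 0 < q%:R)) ?ltr0n //; apply: le_trans nP _.
rewrite mulr_sumr [leRHS]big_mkcond; apply: ler_sum => j _.
rewrite /h -/(idx j); case: ifP => // _.
by rewrite mulrA -exprS addnS -addSn -aE.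
Qed.

End Subsequence.

(** * Convergence and divergence cases for the limsup set *)

Theorem theorem1p6 (R : realType) (b : nat) (D : {set 'I_b}) (m t : nat)
    (a : nat -> nat) (f : R -> R) (psi : nat -> R) :
  (3 <= b)%N ->
  (2 <= #|D| <= b - 1)%N ->
  (* m is the greatest integer with D included in {m, ..., b-1-m} *)
  (forall d : 'I_b, d \in D -> (m <= d)%N && (d + m <= b - 1)%N) ->
  (forall m' : nat, (forall d : 'I_b, d \in D -> (m' <= d)%N && (d + m' <= b - 1)%N) ->
     (m' <= m)%N) ->
  (2 <= t)%N ->
  (forall q : nat, prime q -> (q %| t)%N = (q %| b)%N) ->
  (* A : non-decreasing unbounded sequence of positive integers, n >= 1 *)
  (forall n, (0 < n)%N -> (0 < a n)%N) ->
  (forall n k, (0 < n)%N -> (n <= k)%N -> (a n <= a k)%N) ->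
  (forall M : nat, exists2 n, (0 < n)%N & (M < a n)%N) ->
  (* f dimension function *)
  (forall r, 0 < r -> 0 < f r) ->
  {in `]0, +oo[, continuous f} ->
  {in `]0, +oo[ &, {homo f : x y / x <= y}} ->
  f x @[x --> 0^'+] --> 0 ->
  (* r |-> r^(-gamma) f(r) monotonic *)
  let gamma := ln (#|D|%:R : R) / ln (b%:R : R) in
  ({in `]0, +oo[ &, {homo (fun r => r `^ (- gamma) * f r) : x y / x <= y}} \/
   {in `]0, +oo[ &, {homo (fun r => r `^ (- gamma) * f r) : x y /~ x <= y}}) ->
  (forall n, (0 < n)%N -> 0 < psi n) ->
  let al1 := alpha1 R b t in
  let al2 := alpha2 R b t in
  let thr1 := fun i : nat => (m%:R : R) / ((b%:R - 1) * b%:R ^ Num.floor (i%:R * al1)) in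
  let thr2 := fun i : nat => (m%:R : R) / ((b%:R - 1) * b%:R ^ Num.ceil (i%:R * al2)) in
  let E := W_set t a psi `&` @cantor_set R b D in
  ((\sum_(i <oo | (i \in Iset a) && (thr2 i < psiA a psi i)%R)
      (f (psiA a psi i - thr2 i) * b%:R `^ (i%:R * al2 * gamma))%:E < +oo)%E ->
     hausdorff_measure f E = 0%E) /\
  ((\sum_(i <oo | (i \in Iset a) && (thr1 i < psiA a psi i)%R)
      (f (psiA a psi i - thr1 i) * b%:R `^ (i%:R * al1 * gamma))%:E = +oo)%E ->
     hausdorff_measure f E = hausdorff_measure f (@cantor_set R b D)).

Proof.
move=> b3 /andP[q2 qb] Dm mmax t2 bt a_pos a_le a_unb f0 _ fhomo fcvg gamma fmon psi0.
move=> al1 al2 thr1 thr2 E.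
have b2 : (2 <= b)%N by lia.
have q0 : (0 < #|D|)%N by lia.
have bn n : 0 < b%:R ^+ n :> R by rewrite exprn_gt0 // ltr0n; lia.
have bi n : 0 < (b%:R ^+ n)^-1 :> R by rewrite invr_gt0.
have qn n : 0 < #|D|%:R ^+ n :> R by rewrite exprn_gt0 // ltr0n.
have q1 : 1 <= #|D|%:R :> R by rewrite ler1n.
have fle r s : 0 < r -> r <= s -> f r <= f s.
  by move=> r0 rs; apply: fhomo => //; rewrite in_itv /= andbT // (lt_le_trans r0).
have al1_gt0 : 0 < al1 by exact: alpha1_gt0.
have al2_gt0 : 0 < al2 by exact: alpha2_gt0.
have digitsE X : @cantor_set R b D X -> exists x, digit_code D x X.
  by move=> [_ [x [xD xX]]]; exists x.
have EX X : E X -> exists x, digit_code D x X by move=> [_ /digitsE].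
split.
  have /choice[N NP] : forall i : nat, exists N : nat, Num.ceil (i%:R * al2) = N /\
      (i%:R * al2 <= N%:R < i%:R * al2 + 1).
    by move=> i; have [|N NE NP] := @ceil_nat R (i%:R * al2); [rewrite mulr_ge0 // ltW|exists N].
  have thrE i : thr2 i = m%:R / ((b%:R - 1) * b%:R ^+ N i) by rewrite /thr2 (NP i).1.
  move=> fin.
  have H0 d : 0 < d -> hausdorff_delta f d E = 0%E.
    move=> d0; pose P i := (i \in Iset a) && (thr2 i < psiA a psi i).
    (* The 2 counts the end points, and [#D] pays for rounding [i * al2] up to [N i]. *)
    pose c i := if P i then 2 * #|D|%:R *
      (f (psiA a psi i - thr2 i) * b%:R `^ (i%:R * al2 * gamma)) else 0.
    pose F i : set R := if i \in Iset a then near_grid D (N i) (psiA a psi i) else set0.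
    have [n nd] := exp_inv_lt b2 d0.
    have c0 i : 0 <= c i.
      rewrite /c; case: ifP => // /andP[_ lt].
      by rewrite !mulr_ge0 // ?powR_ge0 // ltW // f0 // subr_gt0.
    (* From this index on [N i >= n], so intervals of level [N i] are shorter than [d]. *)
    apply: (hausdorff_borel_cantelli f0 (F := F) (c := c) (n := (Num.truncn (n%:R / al2)).+1)) => //.
    - move=> X XE i; have [x xX] := EX _ XE; have [XW _] := XE.
      have [j ij [jI [p pX]]] := W_set_often t2 a_le a_unb XW i.
      exists j => //; rewrite /F jI; split; first by exists x.
      have /dvdnP[l lE] := @dvdn_exp_ceil R b t b2 t2 bt j (N j) (andP (NP j).2).1.
      have l0 : l%:R != 0 :> R.
        rewrite pnatr_eq0; apply/eqP => l0; move: lE; rewrite l0 mul0n => /eqP.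
        by rewrite expn_eq0 gtn_eqF // ltnW.
      exists (p * l)%N; rewrite (_ : _ / _ = p%:R / t%:R ^+ j) //.
      by rewrite -(natrX _ b) lE !natrM natrX [l%:R * _]mulrC -mulf_div divff // mulr1.
    - move=> i ni; rewrite /F /c /P; case: ifP => iI; last first.
        rewrite /=; apply: le_trans (hausdorff_delta_seq f0 (s := [::]) _ _) _ => //.
        by rewrite big_nil.
      case: ifP => /= [lt|/negbT]; last first.
        rewrite -leNgt thrE => /near_grid_empty -> //.
        apply: le_trans (hausdorff_delta_seq f0 (s := [::]) _ _) _ => //.
        by rewrite big_nil.
      have lt' := lt; rewrite thrE in lt'.
      have nNi : (n <= N i)%N.
        rewrite -(ler_nat R); apply: le_trans (andP (NP i).2).1.
        rewrite -ler_pdivrMr //; apply: ltW.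
        have /truncn_itv/andP[_] : 0 <= n%:R / al2 by rewrite divr_ge0 // ltW.
        by move=> lt1; apply: lt_le_trans lt1 _; rewrite ler_nat.
      have Nd : (b%:R ^+ N i)^-1 <= d by apply: le_trans (ltW nd); exact: exp_inv_le.
      apply: le_trans (near_grid_cover b2 Dm f0 fle lt' Nd) _.
      rewrite lee_fin -thrE powR_gamma // -!mulrA ler_pM2l //.
      rewrite mulrC mulrCA ler_pM2l ?f0 ?subr_gt0 //.
      rewrite -powR_mulrn // -[X in X * _]powRr1 // -powRD; last first.
        by rewrite pnatr_eq0 -lt0n q0 implybT.
      by apply: ler_powR => //; rewrite addrC; have /andP[_ /ltW] := (NP i).2.
    - rewrite (eq_eseriesr (g := fun i => if P i then ((2 * #|D|%:R)%:E *
        (f (psiA a psi i - thr2 i) * b%:R `^ (i%:R * al2 * gamma))%:E)%E else 0%E)); last first.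
        by move=> i _; rewrite /c; case: ifP.
      rewrite -eseries_mkcond nneseriesZl; last first.
        move=> i /andP[_ lt]; rewrite lee_fin mulr_ge0 ?powR_ge0 // ltW // f0 //.
        by rewrite subr_gt0.
      by apply: lte_mul_pinfty => //; rewrite lee_fin mulr_ge0.
  apply/eqP; rewrite eq_le; apply/andP; split.
    by apply: ge_ereal_sup => _ [d d0 <-]; rewrite H0.
  by rewrite -(H0 1 ltr01); apply: ereal_sup_ubound; exists 1 => //=.
move=> Soo.
have [d0 d0D d0m] : exists2 d0 : 'I_b, d0 \in D & nat_of_ord d0 = m \/ (d0 + m = b - 1)%N.
  apply: contrapT => none; suff : (m.+1 <= m)%N by rewrite ltnn.
  apply: mmax => d dD; have /andP[md db] := Dm d dD.
  rewrite ltn_neqAle md andbT addnS ltn_neqAle db andbT.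
  by apply/andP; split; apply/eqP => e; apply: none; exists d => //; [left|right].
have [d1 d1D d01] : exists2 d1, d1 \in D & d1 != d0.
  have /card_gt1P[x [y [xD yD xy]]] := q2.
  by case: (eqVneq x d0) xy => [->|xd _]; [exists y => //; rewrite eq_sym|exists x].
have /choice[N NP] : forall i : nat, exists N : nat, Num.floor (i%:R * al1) = N /\
    (N%:R <= i%:R * al1 < N%:R + 1).
  by move=> i; have [|N NE NP] := @floor_nat R (i%:R * al1); [rewrite mulr_ge0 // ltW|exists N].
have thrE i : thr1 i = m%:R / ((b%:R - 1) * b%:R ^+ N i) by rewrite /thr1 (NP i).1.
pose P i := (i \in Iset a) && (thr1 i < psiA a psi i).
pose rho i := psiA a psi i - thr1 i.
have rho0 i : P i -> 0 < rho i by case/andP => _; rewrite subr_gt0.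
(* [k i] is the least run length bringing the error below [rho i]; unless it is 0, one letter less
   would not suffice. *)
have /choice[k kP] : forall i, exists k : nat, P i -> (b%:R ^+ (N i + k))^-1 < rho i /\
    (k = 0%N \/ rho i <= (b%:R ^+ (N i + k.-1))^-1).
  move=> i; have [Pi|nPi] := boolP (P i); last by exists 0%N.
  have exk : exists k, (b%:R ^+ (N i + k))^-1 < rho i.
    have [n nr] := exp_inv_lt b2 (rho0 i Pi); exists n; apply: le_lt_trans nr.
    by apply: exp_inv_le => //; exact: leq_addl.
  case: (ex_minnP exk) => k lt kmin; exists k => _; split => //.
  case: k lt kmin => [|k] _ kmin; [by left|right].
  by rewrite leNgt; apply/negP => /kmin; rewrite ltnn.
(* [M * al1 >= 1], so the floor [N] increases strictly over [M] steps. *)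
pose M := (Num.truncn al1^-1).+1.
have N_lt i : (N i < N (M + i))%N.
  rewrite -ltnS -(ltr_nat R) -[X in _ < X]natr1.
  have /andP[le1 _] := (NP i).2; have /andP[_ lt1] := (NP (M + i)%N).2.
  apply: le_lt_trans lt1; rewrite natrD mulrDl -natr1 addrC lerD //.
  rewrite -ler_pdivrMr // mul1r.
  by have /truncn_itv/andP[_ /ltW] : 0 <= al1^-1 by rewrite invr_ge0 ltW.
have runE x X : digit_code D x X -> (forall i0, exists i, [/\ (i0 <= i)%N, P i &
    forall s, (s < k i)%N -> x (N i + s)%N = d0]) -> E X.
  move=> xX runs; have [xcX xD] := xX; have X01 := codes_itv b2 xcX.
  split; last by split=> //; exists x.
  apply: W_set_intro => // i0; have [i [ii0 Pi xrun]] := runs i0.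
  exists i => //; have /andP[iI _] := Pi; split=> //.
  have [p pX] := run_near_grid b2 d0m xX xrun; rewrite -thrE in pX.
  have /dvdnP[l lE] := @dvdn_exp_floor R b t b2 t2 i (N i) (andP (NP i).2).1.
  have l0 : l%:R != 0 :> R.
    rewrite pnatr_eq0; apply/eqP => l0; move: lE; rewrite l0 mul0n => /eqP.
    by rewrite expn_eq0 gtn_eqF // ltnW.
  exists (p * l)%N; rewrite (_ : _ / _ = p%:R / b%:R ^+ N i); last first.
    by rewrite -(natrX _ t) lE !natrM natrX [l%:R * _]mulrC -mulf_div divff // mulr1.
  apply: le_lt_trans pX _; rewrite addrC -ltrBrDr.
  by have [] := kP i Pi.
(* Used with [phi n = #D ^ -n] when [g] is bounded, and with [phi n = f (b ^ -n)] otherwise. Terms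
   with [k i = 0] are at least [e]; for the others [f (rho i) <= f (b ^ -(N i + k i - 1)) <= C * phi
   (N i + k i)], and a factor [#D] pays for rounding down. *)
have subseq (phi : nat -> R) (C e : R) : 0 < e -> 0 <= C -> (forall n, 0 < phi n) ->
    (forall n, f (b%:R ^+ n)^-1 <= C * phi n.+1) -> (forall n, e <= #|D|%:R ^+ n * phi n) ->
    unbounded_sums (fun i => if P i then #|D|%:R ^+ N i * phi (N i + k i)%N else 0).
  move=> e0 C0 phi0 fphi ephi.
  have uoo := nneseries_unbounded _ Soo.
  apply: (unbounded_sums_transfer (C := #|D|%:R * C) e0 _ _ _ (uoo _)) => [i|i||i Pi].
  - by case: ifP => // _; rewrite mulr_ge0 // ltW.
  - rewrite -/(P i); case: ifP => Pi; last by right; rewrite mulr0.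
    have [_ [->|rk]] := kP i Pi; first by left; rewrite addn0.
    have [k0|k0] := posnP (k i); first by left; rewrite k0 addn0.
    right; rewrite powR_gamma //.
    apply: (@le_trans _ _ ((C * phi (N i + k i)%N) * (#|D|%:R * #|D|%:R ^+ N i))); last first.
      by rewrite le_eqVlt; apply/orP; left; apply/eqP; ring.
    apply: ler_pM; rewrite ?powR_ge0 //; first by rewrite ltW // f0 // rho0.
      apply: le_trans (fle _ _ (rho0 i Pi) rk) _; apply: le_trans (fphi _) _.
      by rewrite -addnS prednK.
    rewrite -exprS -powR_mulrn // ler_powR // -natr1.
    by have /andP[_ /ltW] := (NP i).2.
  - by rewrite mulr_ge0.
  - by rewrite mulr_ge0 ?powR_ge0 // ltW // f0 // rho0.
have runsE (idx a' : nat -> nat) : (forall j, N (idx j) = (a' j).+1) ->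
    (forall j, (j <= idx j)%N) -> forall x X, digit_code D x X ->
    runs_often d0 a' (k \o idx) (P \o idx) x -> E X.
  move=> aE idx_ge x X xX runs; apply: runE xX _ => i.
  have [j [Pj ij rj]] := runs i; exists (idx j); split => //.
    exact: leq_trans (idx_ge j).
  by move=> s sk; rewrite aE addSnnS; exact: rj.
(* The values of [r ^ -gamma * f r] at [r = b ^ -n]. *)
pose g n := f (b%:R ^+ n)^-1 * #|D|%:R ^+ n.
have gE n : g n = ((b%:R ^+ n)^-1) `^ (- gamma) * f (b%:R ^+ n)^-1.
  rewrite /g mulrC; congr (_ * _).
  have -> : (b%:R ^+ n)^-1 = b%:R `^ (- n%:R) :> R by rewrite powRN powR_mulrn.
  by rewrite -powRrM mulrNN powR_gamma // powR_mulrn.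
have b_itv n : (b%:R ^+ n)^-1 \in (`]0, +oo[ : interval R) by rewrite in_itv /= andbT.
have [[C gC]|gC] := pselect (exists C, forall n, g n <= C).
  have C0 : 0 < C by apply: lt_le_trans (gC 0%N); rewrite mulr_gt0 // f0.
  have fC n : f (b%:R ^+ n)^-1 <= C / #|D|%:R ^+ n by rewrite ler_pdivlMr //; exact: gC.
  have phi0 n : 0 < (#|D|%:R ^+ n)^-1 :> R by rewrite invr_gt0.
  have oo : unbounded_sums (fun i =>
      if P i then #|D|%:R ^+ N i * (#|D|%:R ^+ (N i + k i))^-1 else 0 : R).
    apply: (subseq (fun n => (#|D|%:R ^+ n)^-1) (C * #|D|%:R) 1) => // [|n|n].
    - by rewrite mulr_ge0 // ltW.
    - by rewrite exprS invfM mulrA mulfK ?gt_eqF // ltr0n.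
    - by rewrite mulfV // gt_eqF.
  have [idx [a' [a_lt aE idx_ge div]]] := increasing_subsequence q0 (ltn0Sn _) N_lt phi0 oo.
  apply: (hausdorff_measure_full b2 f0 fle d0D d1D d01 a_lt (k := k \o idx) (act := P \o idx) fC).
  - move=> i B; have [n nP] := div i B; exists n; apply: le_trans nP _.
    by apply: ler_sum => j _; rewrite exprD invfM mulrA mulfV ?mul1r // gt_eqF.
  - exact: runsE.
  - by move=> X [].
(* If [r ^ -gamma * f r] were non-decreasing in [r], [g] would be bounded by [g 0]; so it is
   non-increasing in [r]. *)
have g_le i j : (i <= j)%N -> g i <= g j.
  move=> ij; case: fmon => fmon; last first.
    by rewrite !gE; apply: (fmon) => //; exact: exp_inv_le.
  exfalso; apply: gC; exists (g 0%N) => n; rewrite !gE; apply: fmon => //.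
  exact: exp_inv_le.
have phi0 n : 0 < f (b%:R ^+ n)^-1 by exact: f0.
have oo : unbounded_sums (fun i =>
    if P i then #|D|%:R ^+ N i * f (b%:R ^+ (N i + k i))^-1 else 0).
  apply: (subseq (fun n => f (b%:R ^+ n)^-1) #|D|%:R (g 0%N)) => // [|n|n].
  - by rewrite mulr_gt0.
  - have := g_le n n.+1 (leqnSn n).
    by rewrite /g [#|D|%:R ^+ n.+1]exprS mulrA ler_pM2r // mulrC.
  - by rewrite mulrC; exact: g_le.
have [idx [a' [a_lt aE idx_ge div]]] := increasing_subsequence q0 (ltn0Sn _) N_lt phi0 oo.
have f_cvg0 e : 0 < e -> exists n, f (b%:R ^+ n)^-1 < e.
  move=> e0; have [d d_gt0 dP] := cvgr_lt _ fcvg e e0.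
  have [n nd] := exp_inv_lt b2 d_gt0; exists n; apply: dP => //=.
  by rewrite sub0r normrN gtr0_norm.
have g_unbounded B : exists n, B < g n.
  apply: contrapT => none; apply: gC; exists B => n.
  by rewrite leNgt; apply/negP => lt; apply: none; exists n.
have inf := hausdorff_measure_infinite b2 f0 fle d0D d1D d01 a_lt f_cvg0 g_le g_unbounded
  (k := k \o idx) (act := P \o idx) div.
(* Both measures are infinite: [inf] applies to [E] and to the whole Cantor set. *)
rewrite inf; last exact: runsE.
rewrite inf // => x X [xX xD] _; split; first exact: codes_itv xX.
by exists x.
Qed.
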